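(* Let $\bar{D}$ be any knot projection with $n$ crossings, and let $A_1 = A_1(\bar{D}) \in M_{n,n+2}(\mathbb{Z})$ be its region choice matrix of the single counting rule. For every integral vector $\boldsymbol{b} \in \mathbb{Z}^n$ there exists $\boldsymbol{u} \in \mathbb{Z}^{n+2}$ such that $$A_1 \boldsymbol{u} + \boldsymbol{b} = \boldsymbol{o}.$$
   Context: A knot projection $\bar{D}$ is the image of a generic immersion of a circle in the sphere $S^2$ (or in the plane, in which case the unbounded region is counted as a region); its only singularities are finitely many transverse double points, called crossings. The connected components of the complement are called regions. If there are $n$ crossings $v_1,\dots,v_n$, then there are $n+2$ regions $r_1,\dots,r_{n+2}$. The region choice matrix of the single counting rule is $A_1(\bar{D}) = (a^{(1)}_{ij}) \in M_{n,n+2}(\mathbb{Z})$, where $a^{(1)}_{ij} = 1$ if the crossing $v_i$ lies on the boundary of the region $r_j$, and $a^{(1)}_{ij}=0$ otherwise. The symbol $\boldsymbol{o}$ denotes the zero vector. *)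

(* Defs.v *)
From mathcomp Require Import all_boot all_order all_algebra.
From mathcomp Require Import all_classical all_reals all_analysis.

Set Implicit Arguments.
Unset Strict Implicit.
Unset Printing Implicit Defensive.

Import Order.TTheory GRing.Theory Num.Theory.
Import numFieldNormedType.Exports.

Local Open Scope classical_set_scope.
Local Open Scope ring_scope.

Section KnotProjection.
Variable R : realType.
Local Notation space := 'rV[R]_3.
Implicit Types (M A : set space) (g : R -> space).

Definition unit_sphere : set space := [set x : space | \sum_i x 0 i ^+ 2 = 1].

Definition coordinate_plane : set space := [set x : space | x 0 ord_max = 0].

(* A map of the circle R/Z is given by its 1-periodic lift to R, so that the
   points of the circle are represented by [0, 1[. *)
Definition crossings g : set space :=
  [set p | exists s t : R, [/\ s \in `[0, 1[, t \in `[0, 1[, s != t,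
                               g s = p & g t = p]].

(* Immersions are C^1.  Both velocities at a double point are tangent to the
   surface M, so the two branches are transverse in M if and only if the
   velocities are linearly independent. *)
Record generic_immersion M g : Prop := GenericImmersion {
  immersion_periodic : forall t, g (t + 1) = g t;
  immersion_in : forall t, M (g t);
  immersion_derivable : forall t : R, derivable g t 1;
  immersion_C1 : continuous (derive1 g);
  immersion_regular : forall t, derive1 g t != 0;
  finite_crossings : finite_set (crossings g);
  no_triple_point : forall s t w : R,
    s \in `[0, 1[ -> t \in `[0, 1[ -> w \in `[0, 1[ ->
    g s = g t -> g t = g w -> [\/ s = t, t = w | s = w];
  transverse_crossings : forall s t : R,
    s \in `[0, 1[ -> t \in `[0, 1[ -> s != t -> g s = g t ->
    row_free (col_mx (derive1 g s) (derive1 g t)) }.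

Definition knot_projection M (D : set space) g : Prop :=
  generic_immersion M g /\ D = range g.

Definition regions M (D : set space) : set (set space) :=
  connected_component (M `\` D) @` (M `\` D).

Definition boundary_in M A : set space :=
  M `&` closure A `&` closure (M `\` A).

Definition region_choice_mx1 M n (v : 'I_n -> space)
    (r : 'I_n.+2 -> set space) : 'M[int]_(n, n.+2) :=
  \matrix_(i, j) (`[< boundary_in M (r j) (v i) >])%:R.

End KnotProjection.

Arguments unit_sphere R : clear implicits.
Arguments coordinate_plane R : clear implicits.

(* Main.v *)
Require Import Defs.
From mathcomp Require Import all_boot all_order all_algebra.
From mathcomp Require Import all_classical all_reals all_analysis.
From mathcomp Require Import ring lra zify.

Set Implicit Arguments.
Unset Strict Implicit.
Unset Printing Implicit Defensive.

Import Order.TTheory GRing.Theory Num.Theory.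
Import numFieldNormedType.Exports.
Local Open Scope classical_set_scope.
Local Open Scope ring_scope.

(** The proof is combinatorial once the local shape of a generic curve is
    understood. It uses neither winding numbers nor the Jordan curve theorem:
    the number n + 2 of regions does their work.

    Travel along the curve. An integral function u on the regions has at each
    time a jump, its value on the left minus its value on the right. The jump
    is constant along an edge. At a crossing with corners NW, SW, SE, NE,
    through which one strand heads east and the other one north, it changes
    by turn u = NE + SW - NW - SE along the first strand and by - turn u along
    the second. If all turns and one jump vanish, then all jumps vanish and u
    is constant, because any two regions are joined by a path that crosses one
    edge at a time. So the n + 1 linear forms given by the n turns and by one
    jump have a common kernel of dimension one in dimension n + 2, and they
    take arbitrary values; solutions with integral data are integral up to a
    constant ([exists_turn]).

    This yields the Alexander numbering, all of whose jumps are 1 and whose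
    parity colours the regions like a checkerboard, with signs sgn. For every
    crossing d it also yields an index function f_d, whose only non-zero turn
    is 1 at d, and whose jumps are 1 or -1 throughout the loop that the curve
    makes between its two visits to d, and 0 elsewhere ([exists_loop_fun]).
    The sum of sgn * u over the four corners of a crossing is turn u up to
    sign; if every corner counted, then sgn * f_d would solve the problem for
    the crossing d.

    A region that has two corners at a crossing is counted only once, though.
    The Alexander numbering shows that these corners can only be SW and NE.
    Call the crossing reducible if they coincide; there the sum lacks one
    value of sgn * u. If d is reducible, then every other crossing is visited
    either twice or never by the loop at d. Let f_d vanish on the region that
    is counted once at d. Following the curve outside the loop, one sees that
    f_d vanishes at all crossings visited there. Hence sgn * f_d meets, besides
    d, only reducible crossings nested in the loop at d, and these are
    eliminated by induction ([separable_reducible]). The other crossings are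
    then solved in the same way ([single_count_surjective]).

    The geometric part produces the data used above. Near a time at which the
    curve passes through no crossing, small displacements in any transverse
    direction move the curve off itself, whence a left and a right region that
    do not change along an edge. At a crossing both strands are graphs over the same line,
    with slopes of opposite signs, and they cut a small box into four connected
    sectors ([two_strands]). That regions are joined by crossing edges follows
    from the connectedness of the plane ([sides_connect_curve]). All of this
    takes place in R * R, which parametrizes the coordinate plane and, by
    stereographic projection from a point that is not on the curve, the rest
    of the sphere. *)

(** * Loops, segments and locally constant functions *)

Lemma loop_shift (R : pzRingType) (T : Type) (f : R -> T) :
  (forall t, f (t + 1) = f t) -> forall t (k : int), f (t + k%:~R) = f t.
Proof.
move=> per.
have nat_shift (j : nat) s : f (s + j%:R) = f s.
  elim: j => [|j IH]; first by rewrite addr0.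
  by rewrite -natr1 addrA per.
move=> t; case=> j; first exact: nat_shift.
by rewrite NegzE -[in RHS](subrK j.+1%:R t) nat_shift mulrNz.
Qed.

Section Preliminaries.
Variable R : realType.

(** The points where f takes the value f a form an open and closed part of the
    interval. This serves for labels along a path in the plane as well as for
    data that depend on the time along the curve. *)
Lemma locally_constant_itv (T : Type) (f : R -> T) (a b : R) : a <= b ->
    (forall t, a <= t <= b -> \forall u \near t, f u = f t) -> f a = f b.
Proof.
move=> ab floc.
pose A := [set t | `[a, b]%classic t /\ f t = f a].
have clop (S : set T) : open [set t | \forall u \near t, S (f u)].
  rewrite openE => t /= St; rewrite /interior; exact: near_join St.
have inab t : `[a, b]%classic t -> a <= t <= b by rewrite /= in_itv.
have near_iff (S : set T) t : `[a, b]%classic t ->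
    (\forall u \near t, S (f u)) <-> S (f t).
  move=> /inab /floc ft; split=> [/nbhs_singleton //|St].
  by near=> u; rewrite (near ft u).
have AE : A = `[a, b]%classic.
  apply: (@segment_connected R a b).
  - by exists a; split => //=; rewrite in_itv /= lexx.
  - exists [set t | \forall u \near t, [set f a] (f u)]; first exact: clop.
    by apply/seteqP; split => t [tab /=] ft; split => //; apply/(near_iff [set f a] t tab).
  exists (~` [set t | \forall u \near t, (~` [set f a]) (f u)]).
    exact/open_closedC/clop.
  apply/seteqP; split => t [tab /=] ft; split => //.
    by move=> /(near_iff (~` [set f a]) t tab); apply.
  apply: contrapT => ft'; apply: ft.
  exact/(near_iff (~` [set f a]) t tab).
have : A b by rewrite AE /= in_itv /= lexx ab.
by case.
Unshelve. all: by end_near. Qed.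

Lemma unit_time (u : R) : exists k : int, 0 <= u - k%:~R < 1.
Proof.
exists (Num.floor u); have := floor_le_tmp u; have := floorD1_gt u.
by rewrite intrD => h1 h2; apply/andP; split; lra.
Qed.

(** A loop is already the image of one compact period. *)
Lemma closed_loop (U : topologicalType) (f : R -> U) : hausdorff_space U ->
  continuous f -> (forall t, f (t + 1) = f t) -> closed (range f).
Proof.
move=> hU cf per.
have -> : range f = f @` `[0, 1]%classic.
  apply/seteqP; split => [z [u _ <-]|z [u _ <-]]; last by exists u.
  have [k /andP[k0 k1]] := unit_time u; exists (u - k%:~R).
    by rewrite /= in_itv /= k0 ltW.
  by rewrite -(loop_shift per _ k) subrK.
apply: compact_closed => //; apply: continuous_compact; last exact: segment_compact.
exact: continuous_subspaceT.
Qed.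

Lemma continuous_pair (T U V : topologicalType) (f : T -> U) (g : T -> V) :
  continuous f -> continuous g -> continuous (fun x => (f x, g x)).
Proof.
by move=> cf cg x; apply: (@cvg_pair _ _ _ _ (nbhs (f x)) (nbhs (g x))); [exact: cf|exact: cg].
Qed.

Lemma derive_loop (f : R -> R) t : (forall u, f (u + 1) = f u) ->
  'D_1 f (t + 1) = 'D_1 f t.
Proof.
move=> per; rewrite /derive per.
have -> // : (fun h => h^-1 *: ((f \o shift (t + 1)) (h *: 1) - f t)) =
          (fun h => h^-1 *: ((f \o shift t) (h *: 1) - f t)).
by apply/funext => h; rewrite /= addrA per.
Qed.

Definition segment (z z' : R * R) x : R * R :=
  (z.1 + x * (z'.1 - z.1), z.2 + x * (z'.2 - z.2)).

Lemma segment0 z z' : segment z z' 0 = z.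
Proof. by rewrite /segment !mul0r !addr0 -surjective_pairing. Qed.

Lemma segment1 z z' : segment z z' 1 = z'.
Proof. by rewrite /segment !mul1r ![_ + (_ - _)]addrC !subrK -surjective_pairing. Qed.

Lemma continuous_segment z z' : continuous (segment z z').
Proof.
by apply: continuous_pair => x; apply: cvgD;
  [exact: cvg_cst|apply: cvgM; [exact: cvg_id|exact: cvg_cst]
  |exact: cvg_cst|apply: cvgM; [exact: cvg_id|exact: cvg_cst]].
Qed.
End Preliminaries.

(** * Counting around the crossings of a diagram *)

(** All that the combinatorial argument needs to know of a curve. The pairs
    [before t] and [after t] consist of the regions on the left and on the
    right of the curve just before and just after the time t; two pairs are
    needed since the regions change at a crossing. The crossing i is visited
    at time false i, heading east, and at time true i, heading north. The last
    two fields express the connectedness of the curve and that of the graph of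
    regions and edges. They quantify over a type V because they are used with
    integers, rationals, booleans and pairs. *)
Record knot_diagram (R : realDomainType) (n : nat) := KnotDiagram {
  before : R -> 'I_n.+2 * 'I_n.+2;
  after : R -> 'I_n.+2 * 'I_n.+2;
  time : bool -> 'I_n -> R;
  NW : 'I_n -> 'I_n.+2;
  SW : 'I_n -> 'I_n.+2;
  SE : 'I_n -> 'I_n.+2;
  NE : 'I_n -> 'I_n.+2;
  sides_periodic : forall t, before (t + 1) = before t /\ after (t + 1) = after t;
  time_ge0 : forall s i, 0 <= time s i;
  time_lt1 : forall s i, time s i < 1;
  time_inj : forall s i s' i', time s i = time s' i' -> s = s' /\ i = i';
  sides_first : forall i,
    before (time false i) = (NW i, SW i) /\ after (time false i) = (NE i, SE i);
  sides_second : forall i,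
    before (time true i) = (SW i, SE i) /\ after (time true i) = (NW i, NE i);
  sides_smooth : forall t,
    (exists s i (k : int), t = time s i + k%:~R) \/ before t = after t;
  sides_travel : forall (V : Type) (F : 'I_n.+2 * 'I_n.+2 -> V) (p q : R),
    p < q -> (forall t, p < t < q -> F (before t) = F (after t)) ->
    F (after p) = F (before q);
  sides_connect : forall (V : Type) (u : 'I_n.+2 -> V),
    (forall t, u (before t).1 = u (before t).2 /\ u (after t).1 = u (after t).2) ->
    forall j k, u j = u k }.

Section Diagram.
Variables (R : realDomainType) (n : nat) (K : knot_diagram R n).
Local Notation m := n.+2.
Local Notation before := (before K).
Local Notation after := (after K).
Local Notation time := (time K).
Local Notation NW := (NW K).
Local Notation SW := (SW K).
Local Notation SE := (SE K).
Local Notation NE := (NE K).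

Lemma before_shift t (k : int) : before (t + k%:~R) = before t.
Proof. by apply: loop_shift => u; have [] := sides_periodic K u. Qed.

Lemma after_shift t (k : int) : after (t + k%:~R) = after t.
Proof. by apply: loop_shift => u; have [] := sides_periodic K u. Qed.

(** Outside the crossings there is nothing to check. *)
Lemma sides_const V (F : 'I_m * 'I_m -> V) p q :
    (forall s i (k : int), p < time s i + k%:~R < q ->
       F (before (time s i)) = F (after (time s i))) ->
  p < q -> F (after p) = F (before q).
Proof.
move=> crossF pq; apply: sides_travel => // t ptq.
case: (sides_smooth K t) => [[s [i [k tE]]]|-> //].
by move: ptq; rewrite tE before_shift after_shift => /crossF.
Qed.

Lemma sides_const_all V (F : 'I_m * 'I_m -> V) :
    (forall s i, F (before (time s i)) = F (after (time s i))) ->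
  forall p q, F (after p) = F (after q) /\ F (before p) = F (after q).
Proof.
move=> crossF.
have same t : F (before t) = F (after t).
  case: (sides_smooth K t) => [[s [i [k ->]]]|-> //].
  by rewrite before_shift after_shift.
have lt_const p q : p < q -> F (after p) = F (after q).
  by move=> pq; rewrite -(same q); apply: sides_const.
have const p q : F (after p) = F (after q).
  by case: (ltgtP p q) => [/lt_const|/lt_const|->].
by move=> p q; rewrite same; split; apply: const.
Qed.

Definition jump (V : zmodType) (u : 'I_m -> V) (p : 'I_m * 'I_m) : V :=
  u p.1 - u p.2.

(** By how much the jump of u changes at the crossing i along the strand that
    heads east; along the other strand it changes by the opposite. *)
Definition turn (V : zmodType) (u : 'I_m -> V) (i : 'I_n) : V :=
  (u (NE i) + u (SW i)) - (u (NW i) + u (SE i)).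

Lemma jump_after (V : comRingType) (u : 'I_m -> V) s i :
  jump u (after (time s i)) =
  jump u (before (time s i)) + (if s then - turn u i else turn u i).
Proof.
rewrite /jump /turn; case: s => /=.
  by have [-> ->] := sides_second K i; rewrite /=; ring.
by have [-> ->] := sides_first K i; rewrite /=; ring.
Qed.

Lemma jump_const (V : comRingType) (u : 'I_m -> V) :
  (forall i, turn u i = 0) ->
  forall t, jump u (before t) = jump u (before 0) /\
            jump u (after t) = jump u (before 0).
Proof.
move=> turn0 t.
have crossj s i : jump u (before (time s i)) = jump u (after (time s i)).
  by rewrite jump_after turn0 oppr0; case: s; rewrite addr0.
have [ta tb] := sides_const_all crossj t 0; have [_ b0] := sides_const_all crossj 0 0.
by rewrite ta tb b0.
Qed.

Lemma jump0_const (V : comRingType) (u : 'I_m -> V) :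
  (forall t, jump u (before t) = 0 /\ jump u (after t) = 0) ->
  forall j k, u j = u k.
Proof.
move=> ju; apply: (sides_connect (k0 := K)) => t; have [jb ja] := ju t.
by split; apply/eqP; rewrite -subr_eq0; apply/eqP.
Qed.

(** The n + 1 linear forms on the left-hand sides vanish together only on the
    constants, and the space of all u has dimension n + 2. *)
Lemma exists_rat_turn (c : 'I_n -> rat) (d : rat) :
  exists u : 'I_m -> rat, (forall i, turn u i = c i) /\ jump u (before 0) = d.
Proof.
(* Column 0 computes the jump at time 0, the other columns the turns. *)
pose D : 'M[rat]_(m, n.+1) := \matrix_(j < m, i < n.+1)
  if unlift ord0 i is Some i' then turn (fun l => (l == j)%:R) i'
  else jump (fun l => (l == j)%:R) (before 0).
have coord (u : 'rV[rat]_m) l : \sum_j u 0 j * (l == j)%:R = u 0 l.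
  rewrite (bigD1 l) //= eqxx mulr1 big1 ?addr0 // => j /negPf.
  by rewrite eq_sym => ->; rewrite mulr0.
have mulD (u : 'rV[rat]_m) i : (u *m D) 0 i =
    if unlift ord0 i is Some i' then turn (u 0) i' else jump (u 0) (before 0).
  rewrite mxE; under eq_bigr do rewrite mxE.
  case: (unlift ord0 i) => [i'|]; rewrite /turn /jump.
    under eq_bigr do rewrite mulrBr !mulrDr.
    by rewrite sumrB !big_split /= !coord.
  under eq_bigr do rewrite mulrBr.
  by rewrite sumrB !coord.
have kerD : (kermx D <= (const_mx 1 : 'rV[rat]_m))%MS.
  apply/rV_subP => u /sub_kermxP uD0.
  have turn0 i : turn (u 0) i = 0.
    by have := mulD u (lift ord0 i); rewrite liftK uD0 mxE.
  have jump0 : jump (u 0) (before 0) = 0.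
    by have := mulD u ord0; rewrite unlift_none uD0 mxE.
  have uC : forall j k, u 0 j = u 0 k.
    by apply: jump0_const => t; rewrite !(jump_const turn0 t).1 (jump_const turn0 t).2.
  apply/sub_rVP; exists (u 0 0); apply/rowP => j; rewrite !mxE mulr1.
  exact: uC.
have fullD : row_full D.
  rewrite /row_full eqn_leq rank_leq_col /=.
  have := mxrankS kerD; rewrite mxrank_ker.
  have := rank_leq_row (const_mx 1 : 'rV[rat]_m); lia.
pose t : 'rV[rat]_n.+1 := \row_i if unlift ord0 i is Some i' then c i' else d.
have /submxP [u uE] : (t <= D)%MS by exact: submx_full.
exists (u 0); split => [i|].
  by have := mulD u (lift ord0 i); rewrite -uE mxE liftK.
by have := mulD u ord0; rewrite -uE mxE unlift_none.
Qed.

(** All jumps of a rational solution are integers. As jumps connect all the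
    regions, its values differ by integers, and subtracting one of them makes
    the solution integral. *)
Lemma exists_turn (c : 'I_n -> int) (d : int) :
  exists u : 'I_m -> int, (forall i, turn u i = c i) /\ jump u (before 0) = d.
Proof.
have [u [uc ud]] := exists_rat_turn (fun i => (c i)%:~R) d%:~R.
have int_sub (x y : rat) : x - y \is a Num.int ->
    (x \is a Num.int) = (y \is a Num.int).
  move=> xy; have -> : x = y + (x - y) by ring.
  exact: (rpredDr _ xy).
have crossint s i : (jump u (before (time s i)) \is a Num.int) =
                  (jump u (after (time s i)) \is a Num.int).
  apply: int_sub; rewrite jump_after opprD addrA subrr sub0r rpredN.
  by case: s; rewrite ?rpredN uc intr_int.
have jint t : jump u (before t) \is a Num.int /\ jump u (after t) \is a Num.int.
  have d0 : jump u (before 0) \is a Num.int by rewrite ud intr_int.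
  have constint := sides_const_all (F := fun p => jump u p \is a Num.int) crossint.
  have [ta tb] := constint t 0.
  by have [_ b0] := constint 0 0; rewrite ta tb -b0.
have uint j : u j - u ord0 \is a Num.int.
  suff -> : (u j - u ord0 \is a Num.int) = (u ord0 - u ord0 \is a Num.int).
    by rewrite subrr rpred0.
  apply: (sides_connect (k0 := K) (u := fun l => u l - u ord0 \is a Num.int)) => t.
  have [jb ja] := jint t.
  have shift (x y : rat) : x - u ord0 - (y - u ord0) = x - y by ring.
  by split; apply: int_sub; rewrite shift.
pose w j := Num.floor (u j - u ord0).
have wE j : (w j)%:~R = u j - u ord0 by rewrite /w floorK.
exists w; split => [i|]; apply: (@intr_inj rat).
  by rewrite /turn rmorphB !rmorphD /= !wE -uc /turn; ring.
by rewrite /jump rmorphB /= !wE -ud /jump; ring.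
Qed.

(** The Alexander numbering of the regions. *)
Lemma exists_numbering :
  exists A : 'I_m -> int, forall t, jump A (before t) = 1 /\ jump A (after t) = 1.
Proof.
have [A [turnA jumpA]] := exists_turn (fun=> 0) 1.
by exists A => t; rewrite -jumpA; apply: jump_const.
Qed.

Definition lo i := Num.min (time false i) (time true i).
Definition hi i := Num.max (time false i) (time true i).

(** Between its two visits to the crossing i the curve describes a closed
    loop. *)
Definition on_loop i t := lo i < t < hi i.

Lemma lo_lt_hi i : lo i < hi i.
Proof.
rewrite /lo /hi; have [//|//|] := ltgtP (time false i) (time true i).
by move/(time_inj (k0:=K)) => [].
Qed.

Lemma hi_lt_lo1 i : hi i < lo i + 1.
Proof.
have := time_ge0 K false i; have := time_ge0 K true i.
have := time_lt1 K false i; have := time_lt1 K true i.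
by rewrite /lo /hi; case: (ltgtP (time false i) (time true i)); lra.
Qed.

Lemma time_lo_hi s i : time s i = lo i \/ time s i = hi i.
Proof. by rewrite /lo /hi; case: s; case: (ltgtP (time false i)); auto. Qed.

Lemma lo_hi_time i : (exists s, lo i = time s i) /\ (exists s, hi i = time s i).
Proof.
by rewrite /lo /hi; case: (ltgtP (time false i)) => _; split; by [exists true|exists false].
Qed.

Lemma shift_off_lo_hi s d (k : int) :
  ~~ (lo d < time s d + k%:~R < hi d) /\
  ~~ (hi d < time s d + k%:~R < lo d + 1).
Proof.
have := hi_lt_lo1 d; have := lo_lt_hi d.
case: (ltgtP k 0) => [k0|k0|->].
- have : (k%:~R : R) <= -1 by rewrite -[-1]/((-1)%:~R) ler_int; move: k0; clear; lia.
  by case: (time_lo_hi s d) => -> *; split; apply/negP => /andP[]; lra.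
- have : 1 <= (k%:~R : R) by rewrite ler1z.
  by case: (time_lo_hi s d) => -> *; split; apply/negP => /andP[]; lra.
- rewrite mulr0z.
  by case: (time_lo_hi s d) => -> *; split; apply/negP => /andP[]; lra.
Qed.

(** The rest of the curve is the single arc from [hi d] to [lo d + 1], which
    avoids a case distinction at time 0. *)
Lemma off_loop_shift s e d : e != d -> ~~ on_loop d (time s e) ->
  exists k : int, hi d < time s e + k%:~R < lo d + 1.
Proof.
move=> ed; rewrite /on_loop negb_and -!leNgt => off.
have [[s1 loE] [s2 hiE]] := lo_hi_time d.
have neq s' : time s e != time s' d.
  by apply/eqP => /(time_inj (k0:=K)) [_ /eqP]; rewrite (negPf ed).
have := time_ge0 K s e; have := time_lt1 K s e.
have := time_ge0 K s1 d; have := time_lt1 K s2 d.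
have := neq s1; have := neq s2; rewrite -loE -hiE => nhi nlo ? ? ? ?.
case/orP: off => off.
  exists 1; have : time s e < lo d by rewrite lt_neqAle nlo.
  by rewrite mulr1z => ?; apply/andP; split; lra.
exists 0; have : hi d < time s e by rewrite lt_neqAle eq_sym nhi.
by rewrite mulr0z => ?; apply/andP; split; lra.
Qed.

(** The index of the regions with respect to the loop at d. A function whose
    only turn is 1 at d has constant jumps on the loop and on the rest of the
    curve. Subtracting a multiple of the Alexander numbering makes the second
    constant zero; the first one is then the turn at d up to sign. *)
Lemma exists_loop_fun d : exists (f : 'I_m -> int) (c : int),
  [/\ c = 1 \/ c = -1, forall i, turn f i = (i == d)%:R, f (SW d) = 0,
    jump f (after (hi d)) = 0 &
    forall s e, e != d ->
      jump f (before (time s e)) = (if on_loop d (time s e) then c else 0) /\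
      jump f (after (time s e)) = (if on_loop d (time s e) then c else 0)].
Proof.
have [u [turnu _]] := exists_turn (fun i => (i == d)%:R) 0.
have [A jumpA] := exists_numbering.
pose x := jump u (after (hi d)).
pose g j := u j - x * A j.
pose f j := g j - g (SW d).
have jumpf p : jump f p = jump u p - x * jump A p by rewrite /f /g /jump; ring.
have turnA i : turn A i = 0.
  have := jump_after A false i; rewrite (jumpA _).1 (jumpA _).2.
  by rewrite -[X in X = _]addr0 => /addrI.
have turnf i : turn f i = (i == d)%:R.
  rewrite -turnu -[RHS]subr0 -(mulr0 x) -(turnA i) /f /g /turn; ring.
have cross s e : e != d ->
    jump f (before (time s e)) = jump f (after (time s e)).
  move=> ed; rewrite jump_after turnf (negPf ed) oppr0.
  by case: s; rewrite addr0.
have travel p q : p < q ->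
    (forall s (k : int), ~~ (p < time s d + k%:~R < q)) ->
    jump f (after p) = jump f (before q).
  move=> pq offd; apply: (sides_const (F := jump f)) => // s i k inpq.
  apply: cross; apply: contraL inpq => /eqP ->; exact: offd.
have [[s1 loE] [s2 hiE]] := lo_hi_time d.
have jump_hi : jump f (after (hi d)) = 0.
  by rewrite jumpf (jumpA _).2 mulr1 subrr.
have off_const p : hi d < p <= lo d + 1 -> jump f (before p) = 0.
  case/andP=> hp pl; rewrite -jump_hi; apply/esym/travel => // s k.
  have [_] := shift_off_lo_hi s d k; apply: contra => /andP[-> /=].
  by move=> /lt_le_trans; apply.
have jump_lo : jump f (before (lo d)) = 0.
  rewrite -(sides_periodic K _).1; apply: off_const.
  by rewrite hi_lt_lo1 lexx.
pose c := jump f (after (lo d)).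
have c1 : c = 1 \/ c = -1.
  rewrite /c loE jump_after -loE jump_lo turnf eqxx add0r.
  by case: (s1); auto.
have on_const p : lo d < p <= hi d -> jump f (before p) = c.
  case/andP=> hp pl; apply/esym/travel => // s k.
  have [+ _] := shift_off_lo_hi s d k; apply: contra => /andP[-> /=].
  by move=> /lt_le_trans; apply.
exists f, c; split => //; first by rewrite /f subrr.
move=> s e ed; rewrite -(cross s e ed).
suff -> : jump f (before (time s e)) = if on_loop d (time s e) then c else 0 by [].
case: ifPn => [/andP[lt1 lt2]|/(off_loop_shift ed) [k /andP[lt1 lt2]]].
  by rewrite on_const // lt1 ltW.
by rewrite -(before_shift _ k) off_const // lt1 ltW.
Qed.

(** Both sides say that the pairs p, q and x, y do not separate each other. *)
Lemma linked_sym (p q x y : R) :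
  (p == q) = false -> (x == y) = false ->
  (x == p) = false -> (x == q) = false -> (y == p) = false -> (y == q) = false ->
  (Num.min x y < p < Num.max x y) = (Num.min x y < q < Num.max x y) ->
  (Num.min p q < x < Num.max p q) = (Num.min p q < y < Num.max p q).
Proof.
case: (ltgtP p q) => // pq _; case: (ltgtP x y) => // xy _;
case: (ltgtP x p) => // xp _; case: (ltgtP x q) => // xq _;
case: (ltgtP y p) => // yp _; case: (ltgtP y q) => // yq _ _; exfalso; lra.
Qed.

(** Other corners of a crossing never coincide, as [exists_checkerboard]
    shows. *)
Definition reducible d := SW d == NE d.

(** Let f be the index function of the loop at e. The values of f at NE d and
    SW d differ by the difference of its jumps along the two strands of d, so
    they are distinct if exactly one of these strands belongs to the loop at e. *)
Lemma reducible_not_linked d s e : reducible d -> e != d ->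
  on_loop d (time s e) = on_loop d (time (~~ s) e).
Proof.
move=> /eqP red ed.
suff : on_loop d (time false e) = on_loop d (time true e) by case: s.
have [f [c [c1 _ _ _ jumpf]]] := exists_loop_fun e.
have de : d != e by rewrite eq_sym.
have [_ j1] := jumpf false d de; have [j2 _] := jumpf true d de.
move: j1 j2; rewrite (sides_first K d).2 (sides_second K d).1 /jump /= red => j1 j2.
have linked : on_loop e (time false d) = on_loop e (time true d).
  by move: j1 j2; do 2 case: ifP => //; case: c1; lia.
have neq s1 s2 : (time s1 e == time s2 d) = false.
  by apply/eqP => /(time_inj (k0:=K)) [_ /eqP]; rewrite (negPf ed).
have nloop i : (time false i == time true i) = false.
  by apply/eqP => /(time_inj (k0:=K)) [].
exact: (linked_sym (nloop d) (nloop e) (neq false false) (neq false true)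
  (neq true false) (neq true true) linked).
Qed.

(** Follow the curve from d to d outside the loop. The values of f on the left
    and on the right vanish at the start. They do not change at a crossing on
    the way, since both visits to it are off the loop, so that f has no jumps
    there and takes the same value on its four corners. *)
Lemma loop_fun_off d (f : 'I_m -> int) : reducible d -> f (SW d) = 0 ->
    jump f (after (hi d)) = 0 ->
    (forall s e, e != d -> ~~ on_loop d (time s e) ->
      jump f (before (time s e)) = 0 /\ jump f (after (time s e)) = 0) ->
  forall e, e != d -> ~~ on_loop d (time false e) -> f (SW e) = 0.
Proof.
move=> red fd fhi foff e ed off.
pose F (p : 'I_m * 'I_m) := (f p.1, f p.2).
have Fhi : F (after (hi d)) = (0, 0).
  have fNE : f (NE d) = 0 by rewrite -fd (eqP red).
  have [_ [s hiE]] := lo_hi_time d; move: fhi; rewrite hiE.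
  case: s {hiE}; rewrite ?(sides_first K d).2 ?(sides_second K d).2 /F /jump /=.
    by rewrite fNE subr0 => ->.
  by rewrite fNE sub0r => /eqP; rewrite oppr_eq0 => /eqP ->.
have [k /andP[lt1 lt2]] := off_loop_shift ed off.
suff : F (after (hi d)) = F (before (time false e + k%:~R)).
  by rewrite Fhi before_shift (sides_first K e).1 => -[].
apply: (sides_const (F := F)) => // s i j /andP[h1 h2].
have {}h2 : time s i + j%:~R < lo d + 1 by apply: lt_trans lt2.
have id : i != d.
  apply/eqP => iE; have [_] := shift_off_lo_hi s d j.
  by move: h1 h2; rewrite iE => -> ->.

have offi s' : ~~ on_loop d (time s' i).
  suff : ~~ on_loop d (time s i).
    by case: s s' {h1 h2} => -[] //; rewrite (reducible_not_linked _ red id).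
  have := time_ge0 K s i; have := time_lt1 K s i; have := lo_lt_hi d.
  have := hi_lt_lo1 d => *; apply/negP => /andP[l1 l2].
  case: (ltgtP j 0) => [j0|j0|jE].
  - have : (j%:~R : R) <= -1 by rewrite -[-1]/((-1)%:~R) ler_int; move: j0; clear; lia.
    by lra.
  - have : 1 <= (j%:~R : R) by rewrite ler1z.
    by lra.
  - by move: h1; rewrite jE mulr0z; lra.
have [b1 a1] := foff false i id (offi false).
have [b2 a2] := foff true i id (offi true).
move: b1 a1 b2 a2; rewrite (sides_first K i).1 (sides_first K i).2.
rewrite (sides_second K i).1 (sides_second K i).2 /jump /F /=.
move=> /subr0_eq b1 /subr0_eq a1 /subr0_eq b2 /subr0_eq a2.
case: s {h1 h2}; rewrite ?(sides_first K i).1 ?(sides_first K i).2;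
  rewrite ?(sides_second K i).1 ?(sides_second K i).2 /=; congr (_, _); congruence.
Qed.

Definition corner i j := j \in [:: NW i; SW i; SE i; NE i].

Definition single_count (u : 'I_m -> int) i := \sum_(j | corner i j) u j.

(** The parity of the Alexander numbering alternates around a crossing, so the
    signed sum over the four corners is the turn up to sign. If SW and NE
    coincide, their common value is counted once instead of twice. *)
Lemma exists_checkerboard : exists sgn : 'I_m -> int,
  (forall i, [/\ sgn (NW i) = 1 \/ sgn (NW i) = -1, sgn (SE i) = sgn (NW i),
      sgn (SW i) = - sgn (NW i) & sgn (NE i) = - sgn (NW i)]) /\
  forall (u : 'I_m -> int) i, single_count (fun j => sgn j * u j) i =
    sgn (NW i) * ((if reducible i then u (SW i) else 0) - turn u i).
Proof.
have [A jumpA] := exists_numbering.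
pose par (x : int) : int := if (x %% 2)%Z == 0 then 1 else -1.
pose sgn j := par (A j).
have step x y : x - y = 1 -> par x = - par y.
  by rewrite /par => xy; do 2 case: eqP; lia.
have sgnA i : [/\ sgn (NW i) = 1 \/ sgn (NW i) = -1, sgn (SE i) = sgn (NW i),
    sgn (SW i) = - sgn (NW i) & sgn (NE i) = - sgn (NW i)] /\
    [/\ A (NW i) = A (SE i) + 2, A (SW i) = A (SE i) + 1 & A (NE i) = A (SE i) + 1].
  have := jumpA (time false i); have := jumpA (time true i).
  rewrite (sides_first K i).1 (sides_first K i).2 (sides_second K i).1.
  rewrite (sides_second K i).2 /jump /= => -[b2 a2] [b1 a1].
  have s1 := step _ _ b1; have s2 := step _ _ b2.
  have s3 := step _ _ a1; have s4 := step _ _ a2.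
  split; last by split; lia.
  rewrite /sgn; split.
  - by rewrite /par; case: eqP; auto.
  - by rewrite s1 s2 opprK.
  - by rewrite s1 opprK.
  - by rewrite s3 s1 s2 opprK.
exists sgn; split => [i|u i]; first by have [] := sgnA i.
(* Only SW and NE have the same number, so no other corners can coincide. *)
have [[_ sSE sSW sNE] [dNW dSW dNE]] := sgnA i.
have neq j k : A j != A k -> (j == k) = false by apply: contra_neqF => /eqP ->.
have NW_SW : (NW i == SW i) = false by apply: neq; lia.
have NW_SE : (NW i == SE i) = false by apply: neq; lia.
have NW_NE : (NW i == NE i) = false by apply: neq; lia.
have SW_SE : (SW i == SE i) = false by apply: neq; lia.
have SE_NE : (SE i == NE i) = false by apply: neq; lia.
pose l := if reducible i then [:: NW i; SW i; SE i] else [:: NW i; SW i; SE i; NE i].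
have lE : corner i =i l.
  move=> j; rewrite /l /reducible; case: ifP => [/eqP red|//].
  rewrite -topredE /= /corner !inE -red.
  by do 3 case: eqP => //=.
have uniql : uniq l.
  rewrite /l /reducible; case: ifP => red; rewrite /= !inE ?red;
  by rewrite NW_SW NW_SE SW_SE ?NW_NE ?SE_NE.
rewrite /single_count (eq_bigl (fun j => j \in l) _ lE) -big_uniq //= /l /reducible /turn.
case: ifP => [/eqP red|_]; rewrite !big_cons big_nil sSE sSW ?sNE.
  by rewrite -red; ring.
by ring.
Qed.

Definition separable i :=
  exists u : 'I_m -> int, forall e, single_count u e = (e == i)%:R.

Lemma single_count_comb (h : 'I_n -> 'I_m -> int) (c : 'I_n -> int) i :
  single_count (fun j => \sum_e c e * h e j) i = \sum_e c e * single_count (h e) i.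
Proof.
rewrite /single_count exchange_big /=.
by apply: eq_bigr => e _; rewrite mulr_sumr.
Qed.

(** The values of u at the crossings other than d are removed by means of the
    functions that separate these crossings. *)
Lemma separable_triangular d (u : 'I_m -> int) :
    single_count u d = 1 \/ single_count u d = -1 ->
    (forall e, e != d -> single_count u e != 0 -> separable e) ->
  separable d.
Proof.
move=> ud usep.
have /fin_all_exists [h hP] e : exists v : 'I_m -> int,
    if e == d then v = u
    else single_count u e != 0 -> forall i, single_count v i = (i == e)%:R.
  case: eqP => [_|/eqP ed]; first by exists u.
  case: (eqVneq (single_count u e) 0) => [_|ue]; first by exists u.
  by have [v vP] := usep e ed ue; exists v.
pose c e := if e == d then single_count u d else - single_count u d * single_count u e.
exists (fun j => \sum_e c e * h e j) => i.
have ud2 : single_count u d * single_count u d = 1 by case: ud => ->.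
have hd : h d = u by have := hP d; rewrite eqxx.
rewrite single_count_comb (bigD1 d) //= /c eqxx hd.
have term e : e != d -> (if e == d then single_count u d else
    - single_count u d * single_count u e) * single_count (h e) i =
    - single_count u d * (single_count u e * (i == e)%:R).
  move=> ed; have := hP e; rewrite (negPf ed) mulrA.
  case: (eqVneq (single_count u e) 0) => [->|_ ->//]; first by rewrite !(mulr0, mul0r).
rewrite (eq_bigr _ term) -mulr_sumr.
case: (eqVneq i d) => [->|id].
  rewrite big1 ?mulr0 ?addr0 // => e ed.
  by rewrite eq_sym (negPf ed) mulr0.
rewrite (bigD1 i) //= eqxx mulr1 big1 ?addr0 => [|e /andP[_ ei]].
  by rewrite mulNr subrr.
by rewrite eq_sym (negPf ei) mulr0.
Qed.

(** Induction on the number of crossings that the loop at d visits twice. The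
    index function of this loop, with signs, meets only d and reducible
    crossings visited by the loop, and their own loops are shorter. *)
Lemma separable_reducible d : reducible d -> separable d.
Proof.
have [k] := ubnP #|[pred e | on_loop d (time false e) && on_loop d (time true e)]|.
elim: k d => // k IH d; rewrite ltnS => size_d red.
have [f [c [c1 turnf fd fhi jumpf]]] := exists_loop_fun d.
have [sgn [sgnP countE]] := exists_checkerboard.
apply: (@separable_triangular d (fun j => sgn j * f j)).
  rewrite countE red fd turnf eqxx; have [+ _ _ _] := sgnP d.
  by case=> ->; auto.
move=> e ed; rewrite countE turnf (negPf ed) subr0.
case: ifP => [rede|_]; last by rewrite mulr0 eqxx.
case: (boolP (on_loop d (time false e))) => [on|off]; last first.
  rewrite (loop_fun_off red fd fhi _ ed off) ?mulr0 ?eqxx // => s i id offi.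
  by have := jumpf s i id; rewrite (negPf offi).
move=> _; apply: IH => //; apply: leq_trans size_d.
have on' : on_loop d (time true e) by rewrite (reducible_not_linked true red ed) in on *.
apply: proper_card; apply/properP; split; last first.
  exists e; rewrite inE ?on //.
  by rewrite /on_loop; case: (time_lo_hi false e) => ->; rewrite ltxx ?andbF.
apply/fintype.subsetP => i; rewrite !inE => /andP[].
move: on on'; rewrite /on_loop => /andP[a1 a2] /andP[b1 b2].
have {a1 b1} lt_lo : lo d < lo e by rewrite {2}/lo lt_min a1.
have {a2 b2} lt_hi : hi e < hi d by rewrite {1}/hi gt_max a2.
move=> /andP[c1' c2] /andP[d1 d2].
by rewrite !(lt_trans lt_lo) ?(lt_trans _ lt_hi).
Qed.

(** At a crossing d that is not reducible, the signed index function meets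
    only d and reducible crossings. *)
Theorem single_count_surjective (b : 'I_n -> int) :
  exists u : 'I_m -> int, forall i, single_count u i = b i.
Proof.
have /fin_all_exists [h hP] d : separable d.
  have [red|nred] := boolP (reducible d); first exact: separable_reducible.
  have [f [c [c1 turnf fd fhi jumpf]]] := exists_loop_fun d.
  have [sgn [sgnP countE]] := exists_checkerboard.
  apply: (@separable_triangular d (fun j => sgn j * f j)) => [|e ed].
    rewrite countE (negPf nred) turnf eqxx; have [+ _ _ _] := sgnP d.
    by case=> ->; auto.
  rewrite countE turnf (negPf ed) subr0.
  case: ifP => [rede _|_]; last by rewrite mulr0 eqxx.
  exact: separable_reducible.
exists (fun j => \sum_e b e * h e j) => i.
rewrite single_count_comb (bigD1 i) //= hP eqxx mulr1 big1 ?addr0 // => e ei.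
by rewrite hP eq_sym (negPf ei) mulr0.
Qed.
End Diagram.

(** * Sides of a curve in the plane *)

Section Plane.
Variable R : realType.
Implicit Types (v w z : R * R) (h t : R).

Definition cross v w := v.1 * w.2 - v.2 * w.1.

Definition displace z h w : R * R := (z.1 + h * w.1, z.2 + h * w.2).

Definition turn_left v : R * R := (- v.2, v.1).

Lemma continuous_crossl (w : R * R) : continuous (fun z => cross z w).
Proof.
have c1 : continuous (fst : R * R -> R) by move=> p; exact: cvg_fst.
have c2 : continuous (snd : R * R -> R) by move=> p; exact: cvg_snd.
move=> z; apply: (@cvgB _ R _ _ _ (fun z : R * R => z.1 * w.2) (fun z => z.2 * w.1));
  apply: cvgM; try exact: cvg_cst; [exact: c1|exact: c2].
Qed.

Lemma cross_displace z h w : cross (displace z h w) w = cross z w.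
Proof. by rewrite /cross /displace /=; ring. Qed.

Lemma displace0 z w : displace z 0 w = z.
Proof. by case: z => a b; rewrite /displace /= !mul0r !addr0. Qed.

Lemma displace_solve (z p v w : R * R) : cross v w != 0 -> cross z w = cross p w ->
  z = displace p ((cross p v - cross z v) / cross v w) w.
Proof.
rewrite /cross /displace; case: z p v w => [z1 z2] [p1 p2] [v1 v2] [w1 w2] /= D0 E.
have E' : (z1 - p1) * w2 = (z2 - p2) * w1 by lra.
congr (_, _); apply/(mulIf D0); rewrite mulrDl mulrAC divfK //.
  transitivity (z1 * (v1 * w2 - v2 * w1) - v1 * ((z1 - p1) * w2 - (z2 - p2) * w1)); last by ring.
  by rewrite E' subrr mulr0 subr0.
transitivity (z2 * (v1 * w2 - v2 * w1) - v2 * ((z1 - p1) * w2 - (z2 - p2) * w1)); last by ring.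
by rewrite E' subrr mulr0 subr0.
Qed.

End Plane.

(** A generic closed curve in the oriented plane, whose complement carries a
    locally constant labelling. Labels are used instead of components since
    the curve may be the image under a chart of a curve on the sphere: the
    labels are then the regions of the sphere, one of which also contains the
    point at infinity. The velocities at the two visits to a crossing form a
    positive basis in this order, as east and north do. *)
Record labelled_curve (R : realType) (n : nat) := LabelledCurve {
  curve_point : R -> R * R;
  velocity : R -> R * R;
  crossing_time : bool -> 'I_n -> R;
  label : R * R -> 'I_n.+2;
  point_periodic : forall t, curve_point (t + 1) = curve_point t;
  velocity_periodic : forall t, velocity (t + 1) = velocity t;
  point_derive1 : forall t : R, is_derive t (1 : R) (fun u : R => (curve_point u).1 : R) (velocity t).1;
  point_derive2 : forall t : R, is_derive t (1 : R) (fun u : R => (curve_point u).2 : R) (velocity t).2;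
  velocity_continuous : continuous velocity;
  velocity_neq0 : forall t, velocity t <> (0, 0);
  crossing_time_ge0 : forall s i, 0 <= crossing_time s i;
  crossing_time_lt1 : forall s i, crossing_time s i < 1;
  crossing_time_inj : forall s i s' i',
    crossing_time s i = crossing_time s' i' -> s = s' /\ i = i';
  crossing_point : forall i,
    curve_point (crossing_time false i) = curve_point (crossing_time true i);
  crossing_positive : forall i,
    0 < cross (velocity (crossing_time false i)) (velocity (crossing_time true i));
  double_point : forall t t', curve_point t = curve_point t' ->
    (exists k : int, t = t' + k%:~R) \/
    (exists s i (k k' : int),
      t = crossing_time s i + k%:~R /\ t' = crossing_time (~~ s) i + k'%:~R);
  label_locally_constant : forall z, ~ range curve_point z ->
    \forall z' \near z, label z' = label z;
  label_onto : forall j, exists z, ~ range curve_point z /\ label z = j }.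

Section Curve.
Variables (R : realType) (n : nat) (C : labelled_curve R n).
Local Notation point := (curve_point C).
Local Notation velocity := (velocity C).
Local Notation ctime := (crossing_time C).
Local Notation label := (label C).
Implicit Types (v w z : R * R) (h t u : R).

Lemma continuous_point1 : continuous (fun u => (point u).1).
Proof.
move=> t; have /derivable1_diffP := @ex_derive _ _ _ _ _ _ _ (point_derive1 C t).
exact: differentiable_continuous.
Qed.

Lemma continuous_point2 : continuous (fun u => (point u).2).
Proof.
move=> t; have /derivable1_diffP := @ex_derive _ _ _ _ _ _ _ (point_derive2 C t).
exact: differentiable_continuous.
Qed.

Lemma continuous_point : continuous point.
Proof.
have -> : point = fun u => ((point u).1, (point u).2) by apply/funext => u; case: point.
exact: (continuous_pair continuous_point1 continuous_point2).
Qed.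

Lemma point_shift t (k : int) : point (t + k%:~R) = point t.
Proof. exact/loop_shift/point_periodic. Qed.

(** The times of one period at distance at least d from the fiber of the point
    form a compact set, whose image is closed and misses the point. *)
Lemma fiber_near t0 d : 0 < d -> \forall z \near point t0,
  forall u, point u = z -> exists u0, point u0 = point t0 /\ `|u - u0| < d.
Proof.
move=> d0.
pose B := \bigcup_(u0 in [set u0 | point u0 = point t0]) ball u0 d.
have clK : closed (point @` (`[0, 1]%classic `&` ~` B)).
  apply: compact_closed; first exact: norm_hausdorff.
  apply: continuous_compact; first by apply: continuous_subspaceT; exact: continuous_point.
  apply: compact_closedI; first exact: segment_compact.
  apply: open_closedC; apply: bigcup_open => u _; exact: ball_open.
have nK : (~` (point @` (`[0, 1]%classic `&` ~` B))) (point t0).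
  by move=> -[u [_ nBu] uE]; apply: nBu; exists u => //; exact: ballxx.
have := open_nbhs_nbhs (conj (closed_openC clK) nK).
apply: filterS => z nz u uz.
have [k /andP[k0 k1]] := unit_time u.
have : B (u - k%:~R).
  apply: contrapT => nB; apply: nz; exists (u - k%:~R).
    by split => //; rewrite /= in_itv /= k0 ltW.
  by rewrite -(point_shift _ k) subrK.
case=> u0 /= u0E bu; exists (u0 + k%:~R); rewrite point_shift; split => //.
by move: bu; rewrite /ball /= distrC opprD [- u0 - _]addrC addrA.
Qed.

Lemma cross_derive w t :
  is_derive t (1 : R) (fun u => cross (point u) w : R) (cross (velocity t) w).
Proof.
have d1 := point_derive1 C t; have d2 := point_derive2 C t.
have -> : (fun u => cross (point u) w) =
    (fun u => (point u).1 : R) * cst w.2 - (fun u => (point u).2 : R) * cst w.1 by [].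
apply: is_derive_eq; rewrite /cross !scaler0 /GRing.scale /=; ring.
Qed.

Lemma continuous_cross w : continuous (fun u => cross (point u) w).
Proof.
move=> t; have /derivable1_diffP := @ex_derive _ _ _ _ _ _ _ (cross_derive w t).
exact: differentiable_continuous.
Qed.

Lemma cross_incr w p q : p < q ->
    (forall t, p <= t <= q -> 0 < cross (velocity t) w) ->
  cross (point p) w < cross (point q) w.
Proof.
move=> pq pos.
have [||c] := @MVT R (fun u => cross (point u) w) (fun u => cross (velocity u) w) p q pq.
- by move=> x _; exact: cross_derive.
- by apply: continuous_subspaceT => x; exact: continuous_cross.
move=> /[!in_itv] /= /andP[pc cq] E.
by rewrite -subr_gt0 E; apply: mulr_gt0; [apply: pos; rewrite !ltW|rewrite subr_gt0].
Qed.

Lemma cross_near t0 w0 : 0 < cross (velocity t0) w0 ->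
  \forall p \near (t0, w0), 0 < cross (velocity p.1) p.2.
Proof.
move=> pos.
have cv1 : continuous (fun p : R * (R * R) => (velocity p.1).1).
  move=> p; apply: (@continuous_comp _ _ _ fst (fun t => (velocity t).1)).
    exact: cvg_fst.
  apply: (@continuous_comp _ _ _ velocity fst); first exact: velocity_continuous.
  exact: cvg_fst.
have cv2 : continuous (fun p : R * (R * R) => (velocity p.1).2).
  move=> p; apply: (@continuous_comp _ _ _ fst (fun t => (velocity t).2)).
    exact: cvg_fst.
  apply: (@continuous_comp _ _ _ velocity snd); first exact: velocity_continuous.
  exact: cvg_snd.
have cw1 : continuous (fun p : R * (R * R) => p.2.1).
  by move=> p; apply: (@continuous_comp _ _ _ snd fst); [exact: cvg_snd|exact: cvg_fst].
have cw2 : continuous (fun p : R * (R * R) => p.2.2).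
  by move=> p; apply: (@continuous_comp _ _ _ snd snd); exact: cvg_snd.
have cc : continuous (fun p : R * (R * R) => cross (velocity p.1) p.2).
  move=> p; apply: cvgB; apply: cvgM; [exact: cv1|exact: cw2|exact: cv2|exact: cw1].
exact: (cc (t0, w0) _ (lt_nbhsr pos)).
Qed.

Definition simple_time t := forall u, point u = point t -> exists k : int, u = t + k%:~R.

Lemma cross_box t0 w0 : 0 < cross (velocity t0) w0 ->
  exists2 d, 0 < d & forall t w, `|t - t0| < d -> `|w.1 - w0.1| < d ->
    `|w.2 - w0.2| < d -> 0 < cross (velocity t) w.
Proof.
move=> /cross_near /nbhs_ballP [d /= d0 dP]; exists d => // t w tt w1 w2.
apply: (dP (t, w)); split => /=; last split => /=.
all: by rewrite -?ball_normE /= distrC.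
Qed.

Lemma incr_near t0 d w :
    (forall t, `|t - t0| < d -> 0 < cross (velocity t) w) ->
  forall p q, `|p - t0| < d -> `|q - t0| < d -> p < q ->
  cross (point p) w < cross (point q) w.
Proof.
move=> pos p q; rewrite !ltr_distl => /andP[p1 p2] /andP[q1 q2] pq.
by apply: cross_incr => // t /andP[tp tq]; apply: pos; rewrite ltr_distl; apply/andP; split; lra.
Qed.

Lemma inj_near t0 d w :
    (forall t, `|t - t0| < d -> 0 < cross (velocity t) w) ->
  forall p q, `|p - t0| < d -> `|q - t0| < d ->
  cross (point p) w = cross (point q) w -> p = q.
Proof.
move=> pos p q pd qd E.
case: (ltgtP p q) => // /(incr_near pos) ltE.
  by have := ltE pd qd; rewrite E ltxx.
by have := ltE qd pd; rewrite E ltxx.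
Qed.

Lemma continuous_displace : continuous (fun p : R * (R * (R * R)) => displace (point p.1) p.2.1 p.2.2).
Proof.
have cp : continuous (fun p : R * (R * (R * R)) => point p.1).
  by move=> p; apply: (@continuous_comp _ _ _ fst point); [exact: cvg_fst|exact: continuous_point].
have ch : continuous (fun p : R * (R * (R * R)) => p.2.1).
  by move=> p; apply: (@continuous_comp _ _ _ snd fst); [exact: cvg_snd|exact: cvg_fst].
have cw : continuous (fun p : R * (R * (R * R)) => p.2.2).
  by move=> p; apply: (@continuous_comp _ _ _ snd snd); exact: cvg_snd.
apply: continuous_pair => p; apply: cvgD.
- by apply: (@continuous_comp _ _ _ (fun p => point p.1) fst); [exact: cp|exact: cvg_fst].
- apply: cvgM; first exact: ch.
  by apply: (@continuous_comp _ _ _ (fun p => p.2.2) fst); [exact: cw|exact: cvg_fst].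
- by apply: (@continuous_comp _ _ _ (fun p => point p.1) snd); [exact: cp|exact: cvg_snd].
- apply: cvgM; first exact: ch.
  by apply: (@continuous_comp _ _ _ (fun p => p.2.2) snd); [exact: cw|exact: cvg_snd].
Qed.

Lemma box_near (P : R * R -> Prop) t0 w0 : (\forall z \near point t0, P z) ->
  exists2 d, 0 < d & forall t h w, `|t - t0| < d -> `|h| < d ->
    `|w.1 - w0.1| < d -> `|w.2 - w0.2| < d -> P (displace (point t) h w).
Proof.
move=> Pn; have cs : (fun p : R * (R * (R * R)) => displace (point p.1) p.2.1 p.2.2) @
    (t0, ((0 : R), w0)) --> point t0.
  rewrite -[X in _ --> X](displace0 _ w0).
  exact: (@continuous_displace (t0, (0, w0))).
have /nbhs_ballP [d /= d0 dP] := cs _ Pn; exists d => // t h w tt hh w1 w2.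
apply: (dP (t, (h, w))); split => /=; last split => /=; last split => /=.
all: by rewrite -?ball_normE /= distrC ?subr0.
Qed.

(** Near t0 the function [cross (point _) w] is injective, and displacement
    along w does not change it; a displaced point on the curve would therefore
    not be displaced at all. Uniformity in w is needed because the normal
    direction varies along the curve. *)
Lemma off_curve_near t0 w0 : simple_time t0 -> 0 < cross (velocity t0) w0 ->
  exists2 d, 0 < d & forall t h w, `|t - t0| < d -> `|h| < d ->
    `|w.1 - w0.1| < d -> `|w.2 - w0.2| < d -> h != 0 ->
    ~ range point (displace (point t) h w).
Proof.
move=> st0 pos.
have [d1 d1_gt0 pos1] := cross_box pos.
have [d2 d2_gt0 near2] := box_near w0 (fiber_near t0 d1_gt0).
exists (Num.min d1 d2) => [|t h w]; first by rewrite lt_min d1_gt0.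
rewrite !lt_min => /andP[t1 t2] /andP[h1 h2] /andP[w11 w12] /andP[w21 w22] h0 [u _ uE].
have [u0 [/st0 [k ->] ku]] := near2 _ _ _ t2 h2 w12 w22 u uE.
have {}uE : point (u - k%:~R) = displace (point t) h w.
  by rewrite -(point_shift _ k) subrK.
have posw t' : `|t' - t0| < d1 -> 0 < cross (velocity t') w.
  by move=> ?; apply: pos1.
have tE : u - k%:~R = t.
  apply: (inj_near posw) => //; last by rewrite uE cross_displace.
  by rewrite -addrA -opprD [k%:~R + _]addrC.
have := posw t t1; move: uE; rewrite tE /displace /cross; case: (point t) => a b /= [e1 e2].
have {}e1 : h * w.1 = 0 by lra.
have {}e2 : h * w.2 = 0 by lra.
move/eqP: e1; move/eqP: e2; rewrite !mulf_eq0 (negPf h0) /= => /eqP -> /eqP ->.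
by rewrite !mulr0 subrr ltxx.
Qed.

Lemma label_path (c : R -> R * R) a b : a <= b -> continuous c ->
  (forall t, a <= t <= b -> ~ range point (c t)) -> label (c a) = label (c b).
Proof.
move=> ab cc off; apply: (locally_constant_itv (f := label \o c)) => // t tab.
exact: (cc t _ (label_locally_constant (off t tab))).
Qed.

Definition sgn (b : bool) : R := if b then -1 else 1.

Lemma sgn_abs b h : `|sgn b * h| = `|h|.
Proof. by rewrite normrM /sgn; case: b; rewrite ?normrN normr1 mul1r. Qed.

(** The triples (t, h, w) range over a convex set, so a path in this set joins
    any two of them, and the displaced points on it are off the curve. *)
Lemma label_box b t0 w0 : simple_time t0 -> 0 < cross (velocity t0) w0 ->
  exists A, exists2 d, 0 < d & forall t h w, `|t - t0| < d -> 0 < h < d ->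
    `|w.1 - w0.1| < d -> `|w.2 - w0.2| < d ->
    label (displace (point t) (sgn b * h) w) = A.
Proof.
move=> st0 pos; have [d d0 off] := off_curve_near st0 pos.
exists (label (displace (point t0) (sgn b * (d / 2)) w0)), d => // t h w td /andP[h0 hd] w1 w2.
pose mid (x y s : R) := x + s * (y - x).
have mid_near x0 y s : `|y - x0| < d -> 0 <= s <= 1 -> `|mid x0 y s - x0| < d.
  move=> yx /andP[s0 s1]; rewrite /mid addrC addKr normrM ger0_norm //.
  by apply: le_lt_trans yx; rewrite -[leRHS]mul1r ler_wpM2r.
have cmid x y : continuous (mid x y).
  by move=> s; apply: cvgD; [exact: cvg_cst|apply: cvgM; [exact: cvg_id|exact: cvg_cst]].
pose c s := displace (point (mid t0 t s)) (sgn b * mid (d / 2) h s)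
  (mid w0.1 w.1 s, mid w0.2 w.2 s).
have mid0 x y : mid x y 0 = x by rewrite /mid mul0r addr0.
have mid1 x y : mid x y 1 = y by rewrite /mid mul1r addrC subrK.
suff : label (c 0) = label (c 1).
  by rewrite /c !mid0 !mid1 -!surjective_pairing.
apply: label_path => //.
  pose q s := (mid t0 t s, (sgn b * mid (d / 2) h s, (mid w0.1 w.1 s, mid w0.2 w.2 s))).
  have cs : continuous q.
    apply: continuous_pair; first exact: cmid.
    apply: continuous_pair; last by apply: continuous_pair; exact: cmid.
    by move=> s; apply: cvgM; [exact: cvg_cst|exact: cmid].
  move=> s; exact: (continuous_comp (cs s) (@continuous_displace (q s))).
move=> s s01.
have hs : 0 < mid (d / 2) h s < d.
  rewrite /mid; case/andP: s01 => s0 s1.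
  by apply/andP; split; nra.
have hs0 : sgn b * mid (d / 2) h s != 0.
  by rewrite -normr_eq0 sgn_abs normr_eq0 gt_eqF //; case/andP: hs.
apply: off => //=; try exact: mid_near.
by rewrite sgn_abs gtr0_norm; case/andP: hs.
Qed.

(** The label found by leaving the curve at time t in the direction w, if b is
    false, or in the opposite direction, if b is true. For directions w on the
    left of the velocity these are the left and the right label. *)
Definition curve_germ b t w : 'I_n.+2 :=
  xget ord0 [set A | exists2 d, 0 < d &
    forall h, 0 < h < d -> label (displace (point t) (sgn b * h) w) = A].

Lemma germE b t w A d : 0 < d ->
    (forall h, 0 < h < d -> label (displace (point t) (sgn b * h) w) = A) ->
  curve_germ b t w = A.
Proof.
move=> d0 labA; apply: xget_unique => [|B [d' d'0 labB]]; first by exists d.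
have [h /andP[hd hd']] : exists h, (0 < h < d) && (0 < h < d').
  exists (Num.min d d' / 2); rewrite /= !divr_gt0 ?lt_min ?d0 //=.
  by case: (ltP d d') => ?; apply/andP; split; lra.
by rewrite -(labB h hd') labA.
Qed.

Lemma germ_box b t0 w0 : simple_time t0 -> 0 < cross (velocity t0) w0 ->
  exists2 d, 0 < d & forall t w, `|t - t0| < d ->
    `|w.1 - w0.1| < d -> `|w.2 - w0.2| < d ->
    curve_germ b t w = curve_germ b t0 w0 /\
    forall h, 0 < h < d -> label (displace (point t) (sgn b * h) w) = curve_germ b t0 w0.
Proof.
move=> st0 pos; have [A [d d0 labA]] := label_box b st0 pos.
have germA t w : `|t - t0| < d -> `|w.1 - w0.1| < d -> `|w.2 - w0.2| < d ->
    curve_germ b t w = A by move=> td w1 w2; apply: (germE d0) => h hd; apply: labA.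
have A0 : curve_germ b t0 w0 = A by apply: germA; rewrite subrr normr0.
by exists d => // t w td w1 w2; rewrite A0; split => [|h hd]; [exact: germA|exact: labA].
Qed.

Definition curve_normal t := turn_left (velocity t).

Lemma normal_pos t : 0 < cross (velocity t) (curve_normal t).
Proof.
rewrite /curve_normal /cross /=; have := @velocity_neq0 _ _ C t.
case: (velocity t) => a b /= /eqP; rewrite -pair_eqE /= negb_and => ab0.
rewrite mulrN opprK -!expr2.
by case/orP: ab0 => ab0; [apply: ltr_wpDr|apply: ltr_wpDl]; rewrite ?sqr_ge0 ?exprn_even_gt0.
Qed.

Definition curve_side t := (curve_germ false t (curve_normal t), curve_germ true t (curve_normal t)).

(** The directions on the left of the velocity form a convex set, and the germ
    is locally constant on it. *)
Lemma germ_side b t w : simple_time t -> 0 < cross (velocity t) w ->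
  curve_germ b t w = curve_germ b t (curve_normal t).
Proof.
move=> st pos.
pose c := segment w (curve_normal t).
have c0 : c 0 = w by exact: segment0.
have c1 : c 1 = curve_normal t by exact: segment1.
have cc : continuous c by exact: continuous_segment.
rewrite -[in LHS]c0 -[in RHS]c1.
apply: (locally_constant_itv (f := fun s => curve_germ b t (c s))) => // s /andP[s0 s1].
have posc : 0 < cross (velocity t) (c s).
  have -> : cross (velocity t) (c s) =
      (1 - s) * cross (velocity t) w + s * cross (velocity t) (curve_normal t).
    by rewrite /cross /c /segment /=; ring.
  by have := normal_pos t; move: pos; move: (cross _ _) (cross _ _) => x y; nra.
have [d d0 dP] := germ_box b st posc.
have bc : \forall u \near s, ball (c s) d (c u) by exact: (cc s _ (nbhsx_ballx _ _ d0)).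
apply: filterS bc => u [b1 b2].
have [|||-> //] := dP t (c u); first by rewrite subrr normr0.
  by move: b1; rewrite -ball_normE /= distrC.
by move: b2; rewrite -ball_normE /= distrC.
Qed.

Lemma side_near t0 : simple_time t0 -> \forall t \near t0, curve_side t = curve_side t0.
Proof.
move=> st0.
have germ_near b : \forall t \near t0, curve_germ b t (curve_normal t) = curve_germ b t0 (curve_normal t0).
  have [d d0 dP] := germ_box b st0 (normal_pos t0).
  have cn : continuous curve_normal.
    have cv1 : continuous (fun t => (velocity t).1).
      move=> t; apply: (@continuous_comp _ _ _ velocity fst); last exact: cvg_fst.
      exact: velocity_continuous.
    have cv2 : continuous (fun t => (velocity t).2).
      move=> t; apply: (@continuous_comp _ _ _ velocity snd); last exact: cvg_snd.
      exact: velocity_continuous.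
    by apply: continuous_pair => // t; apply: cvgN; exact: cv2.
  have bt : \forall t \near t0, ball t0 d t by exact: nbhsx_ballx.
  have bn : \forall t \near t0, ball (curve_normal t0) d (curve_normal t).
    exact: (cn t0 _ (nbhsx_ballx _ _ d0)).
  apply: filterS2 bt bn => t td [n1 n2].
  have [|||-> //] := dP t (curve_normal t); first by move: td; rewrite -ball_normE /= distrC.
    by move: n1; rewrite -ball_normE /= distrC.
  by move: n2; rewrite -ball_normE /= distrC.
by apply: filterS2 (germ_near false) (germ_near true) => t; rewrite /curve_side => -> ->.
Qed.
End Curve.

(** * The four sectors at a crossing *)

(** In the coordinates below, x is the abscissa of a vertical line, and y and z
    are the heights at which the strands of negative and of positive slope
    meet it. *)
Lemma opposite_slopes (R : realDomainType) (x y z : R) :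
  [\/ x < 0 /\ 0 < y, 0 < x /\ y < 0 | x = 0 /\ y = 0] ->
  [\/ x < 0 /\ z < 0, 0 < x /\ 0 < z | x = 0 /\ z = 0] ->
  (y < z -> [/\ 0 < x, y < 0 & 0 < z]) /\ (z < y -> [/\ x < 0, z < 0 & 0 < y]).
Proof. by case=> -[? ?] [] [? ?]; split => ?; split; lra. Qed.

(** The strand false passes through the crossing at time a and the strand true
    at time b. The coordinates (al, be) refer to the basis q, w made of the sum
    and of the difference of the two velocities, so that both strands proceed
    in the direction of increasing al, the first one descending and the second
    one ascending; (A u, B u) are the coordinates of the curve at time u. *)
Section Strands.
Variables (R : realType) (n : nat) (C : labelled_curve R n).
Local Notation point := (curve_point C).
Local Notation velocity := (velocity C).
Local Notation label := (label C).
Local Notation simple := (simple_time C).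
Local Notation side := (curve_side C).
Local Notation germ := (curve_germ C).
Local Notation normal := (curve_normal C).
Variables a b : R.
Hypothesis meet : point a = point b.
Hypothesis fiber : forall u, point u = point a ->
  exists k : int, u = a + k%:~R \/ u = b + k%:~R.
Hypothesis pos : 0 < cross (velocity a) (velocity b).
Implicit Types (s : bool) (u t al be : R).

Let base s := if s then b else a.
Let P := point a.
Let c := cross (velocity a) (velocity b).
Let w : R * R := ((velocity b).1 - (velocity a).1, (velocity b).2 - (velocity a).2).
Let q : R * R := ((velocity b).1 + (velocity a).1, (velocity b).2 + (velocity a).2).
Let A u := (cross (point u) w - cross P w) / (2 * c).
Let B u := (cross P q - cross (point u) q) / (2 * c).
Let Phi al be : R * R := (P.1 + al * q.1 + be * w.1, P.2 + al * q.2 + be * w.2).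

Let c2_neq0 : 2 * c != 0.
Proof. by rewrite mulf_neq0 // gt_eqF. Qed.

Let cross_qw : cross q w = 2 * c.
Proof. by rewrite /c /q /w /cross /=; ring. Qed.

Lemma Phi_coord (z : R * R) :
  z = Phi ((cross z w - cross P w) / (2 * c)) ((cross P q - cross z q) / (2 * c)).
Proof.
rewrite /Phi; move: cross_qw c2_neq0; rewrite /cross; case: z => x y /=.
move: P q w (2 * c) => [P1 P2] [q1 q2] [w1 w2] D /= <- D0.
by congr (_, _); field.
Qed.

Lemma strand_coord u : point u = Phi (A u) (B u).
Proof. exact: Phi_coord. Qed.

Lemma Phi_inj al be al' be' : Phi al be = Phi al' be' -> al = al' /\ be = be'.
Proof.
move: cross_qw c2_neq0; rewrite /Phi /cross.
move: P q w (2 * c) => [P1 P2] [q1 q2] [w1 w2] D /= <- D0 [e1 e2].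
have E1 : (al - al') * q1 + (be - be') * w1 = 0 by lra.
have E2 : (al - al') * q2 + (be - be') * w2 = 0 by lra.
split; apply/eqP; rewrite -subr_eq0; apply/eqP/(mulIf D0).
  transitivity (((al - al') * q1 + (be - be') * w1) * w2 -
     ((al - al') * q2 + (be - be') * w2) * w1); first by ring.
  by rewrite E1 E2; ring.
transitivity (((al - al') * q2 + (be - be') * w2) * q1 -
     ((al - al') * q1 + (be - be') * w1) * q2); first by ring.
by rewrite E1 E2; ring.
Qed.

Lemma displace_Phi al be h : displace (Phi al be) h w = Phi al (be + h).
Proof. by rewrite /displace /Phi /= !mulrDl !addrA. Qed.

Lemma continuous_Phi : continuous (fun p => Phi p.1 p.2).
Proof.
have c1 : continuous (fst : R * R -> R) by move=> p; exact: cvg_fst.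
have c2 : continuous (snd : R * R -> R) by move=> p; exact: cvg_snd.
apply: continuous_pair => p; apply: cvgD; try (apply: cvgD; first exact: cvg_cst);
  by apply: cvgM; try exact: cvg_cst; [exact: c1 || exact: c2].
Qed.

Lemma strand_base s : [/\ point (base s) = P, A (base s) = 0 & B (base s) = 0].
Proof.
have E : point (base s) = P by case: s.
by rewrite /A /B E !subrr !mul0r.
Qed.

Lemma continuous_A : continuous A.
Proof.
move=> u; apply: cvgM; last exact: cvg_cst.
by apply: cvgB; [exact: continuous_cross|exact: cvg_cst].
Qed.

Lemma continuous_B : continuous B.
Proof.
move=> u; apply: cvgM; last exact: cvg_cst.
by apply: cvgB; [exact: cvg_cst|exact: continuous_cross].
Qed.

(** Up to sign, scale and an additive constant, A and B are of the form
    [cross (point _) v] for directions v such that [cross (velocity _) v] is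
    positive near the crossing. *)
Lemma strand_mono : exists2 d0, 0 < d0 & forall s,
  (forall u, `|u - base s| < d0 -> 0 < cross (velocity u) w) /\
  forall u1 u2, `|u1 - base s| < d0 -> `|u2 - base s| < d0 -> u1 < u2 ->
    A u1 < A u2 /\ sgn R s * B u2 < sgn R s * B u1.
Proof.
have D0 : 0 < 2 * c by rewrite mulr_gt0.
have one s : exists2 d0, 0 < d0 & forall u, `|u - base s| < d0 ->
    0 < cross (velocity u) w /\
    0 < cross (velocity u) (sgn R s * q.1, sgn R s * q.2).
  have cw : 0 < cross (velocity (base s)) w.
    suff -> : cross (velocity (base s)) w = c by [].
    by rewrite /c /w /base /cross; case: (s) => /=; ring.
  have cq : 0 < cross (velocity (base s)) (sgn R s * q.1, sgn R s * q.2).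
    suff -> : cross (velocity (base s)) (sgn R s * q.1, sgn R s * q.2) = c by [].
    by rewrite /c /q /base /cross /sgn; case: (s) => /=; ring.
  have [d1 d1_gt0 P1] := cross_box cw; have [d2 d2_gt0 P2] := cross_box cq.
  exists (Num.min d1 d2) => [|u]; first by rewrite lt_min d1_gt0.
  by rewrite lt_min => /andP[u1 u2]; split; [apply: P1|apply: P2]; rewrite ?subrr ?normr0.
have [d1 d1_gt0 P1] := one false; have [d2 d2_gt0 P2] := one true.
exists (Num.min d1 d2) => [|s]; first by rewrite lt_min d1_gt0.
have Pd u : `|u - base s| < Num.min d1 d2 -> 0 < cross (velocity u) w /\
    0 < cross (velocity u) (sgn R s * q.1, sgn R s * q.2).
  by rewrite lt_min => /andP[]; case: (s) => u1 u2; [exact: P2|exact: P1].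
split => [u /Pd[] //|u1 u2 n1 n2 u12].
have incw := incr_near (fun u ud => (Pd u ud).1) n1 n2 u12.
have incq := incr_near (fun u ud => (Pd u ud).2) n1 n2 u12.
rewrite /A /B !mulrA !ltr_pM2r ?invr_gt0 //; split; first by lra.
move: incq; rewrite /cross /= !mulrBr; lra.
Qed.

Lemma fiber_box d0 : 0 < d0 -> exists2 e0, 0 < e0 & forall al be,
  `|al| < e0 -> `|be| < e0 -> forall u, point u = Phi al be ->
  exists s (k : int), `|u - k%:~R - base s| < d0.
Proof.
move=> d0_gt0.
have Phi0 : Phi 0 0 = P by rewrite /Phi !mul0r !addr0 -surjective_pairing.
have cP : (fun p : R * R => Phi p.1 p.2) @ ((0 : R), (0 : R)) --> P.
  by rewrite -Phi0; exact: (@continuous_Phi (0, 0)).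
have /nbhs_ballP [e0 /= e0_gt0 eP] := cP _ (fiber_near C a d0_gt0).
exists e0 => // al be al_lt be_lt u uE.
have [|u0 [/fiber [k kE] ud]] := eP (al, be) _ u uE.
  by split => /=; rewrite -ball_normE /= sub0r normrN.
case: kE => kE; [exists false, k|exists true, k]; move: ud; rewrite kE /=.
  by rewrite opprD addrA addrAC.
by rewrite opprD addrA addrAC.
Qed.

Lemma strand_ivt (d1 : R) : 0 < d1 ->
    (forall s u1 u2, `|u1 - base s| < d1 -> `|u2 - base s| < d1 -> u1 < u2 ->
      A u1 < A u2) ->
  exists2 e1, 0 < e1 & forall s al, `|al| < e1 ->
    exists2 u, `|u - base s| < d1 & A u = al.
Proof.
move=> d1_gt0 mono.
have one s : exists2 e1, 0 < e1 & forall al, `|al| < e1 ->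
    exists2 u, `|u - base s| < d1 & A u = al.
  have [_ A0 _] := strand_base s.
  have n0 : `|base s - base s| < d1 by rewrite subrr normr0.
  have nl : `|base s - d1 / 2 - base s| < d1 by rewrite ltr_norml; lra.
  have nr : `|base s + d1 / 2 - base s| < d1 by rewrite ltr_norml; lra.
  have l0 : A (base s - d1 / 2) < 0 by rewrite -A0; apply: (mono s) => //; lra.
  have r0 : 0 < A (base s + d1 / 2) by rewrite -A0; apply: (mono s) => //; lra.
  exists (Num.min (- A (base s - d1 / 2)) (A (base s + d1 / 2))).
    by rewrite lt_min oppr_gt0 l0.
  move=> al; rewrite lt_min !ltr_norml => /andP[/andP[l1 l2] /andP[r1 r2]].
  have [|||u] := @IVT R A (base s - d1 / 2) (base s + d1 / 2) al.
  - lra.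
  - by apply: continuous_subspaceT; exact: continuous_A.
  - rewrite ge_min le_max; apply/andP; split; apply/orP; [left|right]; lra.
  rewrite in_itv /= => /andP[u1 u2] uE; exists u => //.
  by rewrite ltr_norml; lra.
have [e1 e1_gt0 P1] := one false; have [e2 e2_gt0 P2] := one true.
exists (Num.min e1 e2) => [|s al]; first by rewrite lt_min e1_gt0.
by rewrite lt_min => /andP[]; case: s; auto.
Qed.

Lemma strand_small e0 : 0 < e0 -> exists2 d1, 0 < d1 & forall s u,
  `|u - base s| < d1 -> `|A u| < e0 /\ `|B u| < e0.
Proof.
move=> e0_gt0.
have one s : \forall u \near base s, `|A u| < e0 /\ `|B u| < e0.
  have [_ A0 B0] := strand_base s.
  have nA : \forall u \near base s, ball 0 e0 (A u).
    by rewrite -A0; exact: (@continuous_A (base s) _ (nbhsx_ballx _ _ e0_gt0)).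
  have nB : \forall u \near base s, ball 0 e0 (B u).
    by rewrite -B0; exact: (@continuous_B (base s) _ (nbhsx_ballx _ _ e0_gt0)).
  by apply: filterS2 nA nB => u; rewrite -!ball_normE /= !sub0r !normrN.
have /nbhs_ballP [d1 /= d1_gt0 P1] := one false.
have /nbhs_ballP [d2 /= d2_gt0 P2] := one true.
exists (Num.min d1 d2) => [|s u]; first by rewrite lt_min d1_gt0.
by rewrite lt_min => /andP[]; case: s => u1 u2; [apply: P2|apply: P1];
  rewrite -ball_normE /= distrC.
Qed.

(** In time radius d0 the strands are monotone; in the box of radius e0 they
    are the only parts of the curve; in time radius d1 they stay in the inner
    half of the box; and both of them pass over all abscissas up to e1. *)
Lemma local_model : exists d0 e0 d1 e1 : R,
  [/\ 0 < e1, e1 <= e0, 0 < d1 & d1 <= d0] /\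
  [/\ forall s u, `|u - base s| < d0 -> 0 < cross (velocity u) w,
      forall s u1 u2, `|u1 - base s| < d0 -> `|u2 - base s| < d0 -> u1 < u2 ->
        A u1 < A u2 /\ sgn R s * B u2 < sgn R s * B u1,
      forall al be, `|al| < e0 -> `|be| < e0 -> forall u, point u = Phi al be ->
        exists s (k : int), `|u - k%:~R - base s| < d0,
      forall s u, `|u - base s| < d1 -> `|A u| < e0 / 2 /\ `|B u| < e0 / 2 &
      forall s al, `|al| < e1 -> exists2 u, `|u - base s| < d1 & A u = al].
Proof.
have [d0 d0_gt0 mono] := strand_mono.
have [e0 e0_gt0 box] := fiber_box d0_gt0.
have [d1 d1_gt0 small] : exists2 d1, 0 < d1 & forall s u,
    `|u - base s| < d1 -> `|A u| < e0 / 2 /\ `|B u| < e0 / 2.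
  by apply: strand_small; rewrite divr_gt0.
have d2_gt0 : 0 < Num.min d0 d1 by rewrite lt_min d0_gt0.
have [|e1 e1_gt0 ivt] := strand_ivt d2_gt0.
  move=> s u1 u2; rewrite !lt_min => /andP[n1 _] /andP[n2 _] u12.
  by have [] := (mono s).2 u1 u2 n1 n2 u12.
exists d0, e0, (Num.min d0 d1), (Num.min e0 e1); split.
  by split; rewrite ?lt_min ?e0_gt0 ?e1_gt0 ?d0_gt0 ?d1_gt0 // ge_min lexx.
split => //.
- by move=> s; exact: (mono s).1.
- by move=> s; exact: (mono s).2.
- by move=> s u; rewrite lt_min => /andP[_]; exact: small.
by move=> s al; rewrite lt_min => /andP[_]; exact: ivt.
Qed.

Section Window.
Variables d0 e0 d1 e1 : R.
Hypotheses (e1_gt0 : 0 < e1) (e10 : e1 <= e0) (d1_gt0 : 0 < d1) (d10 : d1 <= d0).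
Hypothesis transverse : forall s u, `|u - base s| < d0 -> 0 < cross (velocity u) w.
Hypothesis mono : forall s u1 u2, `|u1 - base s| < d0 -> `|u2 - base s| < d0 ->
  u1 < u2 -> A u1 < A u2 /\ sgn R s * B u2 < sgn R s * B u1.
Hypothesis box : forall al be, `|al| < e0 -> `|be| < e0 ->
  forall u, point u = Phi al be -> exists s (k : int), `|u - k%:~R - base s| < d0.
Hypothesis small : forall s u, `|u - base s| < d1 -> `|A u| < e0 / 2 /\ `|B u| < e0 / 2.
Hypothesis ivt : forall s al, `|al| < e1 -> exists2 u, `|u - base s| < d1 & A u = al.

Let e0_gt0 : 0 < e0.
Proof. exact: lt_le_trans e10. Qed.

Let lt_e0 al : `|al| < e1 -> `|al| < e0.
Proof. by move=> /lt_le_trans; apply. Qed.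

Let base_near s : `|base s - base s| < d0.
Proof. by rewrite subrr normr0 (lt_le_trans d1_gt0). Qed.

Lemma strand_inj s u1 u2 :
  `|u1 - base s| < d0 -> `|u2 - base s| < d0 -> A u1 = A u2 -> u1 = u2.
Proof.
move=> n1 n2 E; case: (ltgtP u1 u2) => // lt12.
  by have [] := mono n1 n2 lt12; rewrite E ltxx.
by have [] := mono n2 n1 lt12; rewrite E ltxx.
Qed.

Lemma strand_before s u : `|u - base s| < d0 -> u < base s ->
  A u < 0 /\ 0 < sgn R s * B u.
Proof.
move=> nu lt; have [_ A0 B0] := strand_base s.
by have := mono nu (base_near s) lt; rewrite A0 B0 mulr0.
Qed.

Lemma strand_after s u : `|u - base s| < d0 -> base s < u ->
  0 < A u /\ sgn R s * B u < 0.
Proof.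
move=> nu lt; have [_ A0 B0] := strand_base s.
by have := mono (base_near s) nu lt; rewrite A0 B0 mulr0.
Qed.

Lemma strand_sgn s u : `|u - base s| < d0 ->
  [\/ A u < 0 /\ 0 < sgn R s * B u, 0 < A u /\ sgn R s * B u < 0 | A u = 0 /\ B u = 0].
Proof.
move=> nu; case: (ltgtP u (base s)) => [/(strand_before nu)|/(strand_after nu)|->].
- by constructor 1.
- by constructor 2.
- by have [_ -> ->] := strand_base s; constructor 3.
Qed.

Lemma sgnN s s' : s' != s -> sgn R s' = - sgn R s.
Proof. by rewrite /sgn; case: s; case: s' => //; rewrite opprK. Qed.

Lemma strand_disjoint s s' u u' : `|u - base s| < d0 -> `|u' - base s'| < d0 ->
  A u != 0 -> A u' = A u -> B u' = B u -> u' = u.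
Proof.
move=> nu nu' Au0 EA EB; have [sE|s's] := eqVneq s' s.
  by apply: (strand_inj (s := s)) => //; rewrite -sE.
have := strand_sgn nu; have := strand_sgn nu'; rewrite EA EB (sgnN s's) mulNr.
move: Au0 => /eqP Au0; move: (A u) (sgn R s * B u) Au0 => x y x0.
by case=> [[? ?]|[? ?]|[]] // [[? ?]|[? ?]|[]] //; lra.
Qed.

Lemma window_hit al be : `|al| < e0 -> `|be| < e0 -> range point (Phi al be) ->
  exists s u, [/\ `|u - base s| < d0, A u = al & B u = be].
Proof.
move=> al_lt be_lt [u _ uE]; have [s [k uk]] := box al_lt be_lt uE.
exists s, (u - k%:~R); have : point (u - k%:~R) = Phi al be.
  by rewrite -(point_shift _ _ k) subrK.
by rewrite strand_coord => /Phi_inj [].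
Qed.

Lemma column_bound s u : `|A u| < e1 -> `|u - base s| < d0 -> `|B u| < e0 / 2.
Proof.
move=> Ae nu; have [u' nu' E] := ivt s Ae.
by rewrite -(strand_inj (lt_le_trans nu' d10) nu E); exact: (small nu').2.
Qed.

Lemma label_vertical al be be' : `|al| < e1 -> - e0 < be -> be <= be' -> be' < e0 ->
    (forall s u, `|u - base s| < d0 -> A u = al -> ~~ (be <= B u <= be')) ->
  label (Phi al be) = label (Phi al be').
Proof.
move=> al_lt be_gt be_le be_lt avoid.
apply: (label_path (c := Phi al)) => // [x|x /andP[x1 x2]].
  apply: (@continuous_comp _ _ _ (fun x => (al, x)) (fun p => Phi p.1 p.2)).
    by apply: (@cvg_pair _ _ _ _ (nbhs al) (nbhs x)); [exact: cvg_cst|exact: cvg_id].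
  exact: continuous_Phi.
move=> /window_hit [||s [u [nu Au Bu]]]; first exact: lt_e0.
  by rewrite ltr_norml (lt_le_trans be_gt x1) (le_lt_trans x2 be_lt).
by have := avoid s u nu Au; rewrite Bu x1 x2.
Qed.

(** J stands for an interval; the uses differ in whether 0 belongs to it. *)
Lemma label_horizontal be (J : R -> Prop) :
    (forall x y z, J x -> J z -> x <= y <= z -> J y) ->
    (forall x, J x -> ~ range point (Phi x be)) ->
  forall al al', J al -> J al' -> label (Phi al be) = label (Phi al' be).
Proof.
move=> Jconvex off.
have le_path al al' : al <= al' -> J al -> J al' ->
    label (Phi al be) = label (Phi al' be).
  move=> le Jal Jal'; apply: (label_path (c := fun x => Phi x be)) => // x.
    apply: (@continuous_comp _ _ _ (fun x => (x, be)) (fun p => Phi p.1 p.2)).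
      by apply: (@cvg_pair _ _ _ _ (nbhs x) (nbhs be)); [exact: cvg_id|exact: cvg_cst].
    exact: continuous_Phi.
  by move=> xal; apply: off; apply: Jconvex xal.
by move=> al al' Jal Jal'; case: (leP al al') => [|/ltW] le; [|apply/esym]; exact: le_path.
Qed.

(** Over the abscissas up to e1 the strands stay below the height e0 / 2, so
    horizontal lines at the heights top and - top avoid the curve and stay in
    the box. The corner labels are read on the two axes. *)
Let top := 3 / 4 * e0.

Let top_e0 : e0 / 2 < top /\ top < e0.
Proof. by rewrite /top; split; have := e0_gt0; lra. Qed.

Let half_lt_top al s u : `|al| < e1 -> `|u - base s| < d0 -> A u = al -> - top < B u < top.
Proof.
move=> al_lt nu Au; have := column_bound (s := s) (u := u); rewrite Au => /(_ al_lt nu).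
by have [h _] := top_e0; rewrite -ltr_norml => /lt_trans; apply.
Qed.

Let nw := label (Phi 0 top).
Let se := label (Phi 0 (- top)).
Let sw := label (Phi (- (e1 / 2)) 0).
Let ne := label (Phi (e1 / 2) 0).

(** The heights top and - top are beyond both strands. *)
Lemma label_edge al be : `|al| < e1 -> be = top \/ be = - top ->
  label (Phi al be) = label (Phi 0 be).
Proof.
move=> al_lt beE; apply: (label_horizontal (J := fun x => `|x| < e1)) => //.
- move=> x y z; rewrite !ltr_norml => /andP[x1 _] /andP[_ z2] /andP[xy yz].
  by rewrite (lt_le_trans x1 xy) (le_lt_trans yz z2).
- move=> x x_lt /window_hit [||s [u [nu Au Bu]]]; first exact: lt_e0.
    have [h1 h2] := top_e0; have t0 : 0 < top.
      by apply: lt_trans h1; rewrite divr_gt0.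
    by case: beE => ->; rewrite ?normrN gtr0_norm.
  have := half_lt_top x_lt nu Au; rewrite Bu.
  by case: beE => ->; rewrite ltxx ?andbF.
- by rewrite normr0.
Qed.

Lemma off_axis al : `|al| < e1 -> al != 0 -> ~ range point (Phi al 0).
Proof.
move=> al_lt /eqP al0 /window_hit [||s [u [nu Au Bu]]]; first exact: lt_e0.
  by rewrite normr0.
by have := strand_sgn nu; rewrite Au Bu mulr0 ltxx => -[] [].
Qed.

(** At height 0 the curve is met only at the crossing, since strands of opposite
    slopes have heights of opposite signs over al != 0. *)
Lemma label_axis al : `|al| < e1 -> al != 0 ->
  label (Phi al 0) = if al < 0 then sw else ne.
Proof.
move=> al_lt al0; have half : `|e1 / 2| < e1.
  by rewrite gtr0_norm ?divr_gt0 // ltr_pdivrMr // ltr_pMr // ltr1n.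
case: (ltgtP al 0) al0 => // al0 _.
  apply: (label_horizontal (J := fun x => `|x| < e1 /\ x < 0)) => //.
  - move=> x y z; rewrite !ltr_norml => -[/andP[x1 _] x0] [/andP[_ z2] z0] /andP[xy yz].
    by rewrite (lt_le_trans x1 xy) (le_lt_trans yz z2) (le_lt_trans yz z0).
  - by move=> x [x_lt x0]; apply: off_axis; rewrite // lt_eqF.
  - by rewrite normrN; split=> //; rewrite oppr_lt0 divr_gt0.
apply: (label_horizontal (J := fun x => `|x| < e1 /\ 0 < x)) => //.
- move=> x y z; rewrite !ltr_norml => -[/andP[x1 _] x0] [/andP[_ z2] z0] /andP[xy yz].
  by rewrite (lt_le_trans x1 xy) (le_lt_trans yz z2) (lt_le_trans x0 xy).
- by move=> x [x_lt x0]; apply: off_axis; rewrite // gt_eqF.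
- by split=> //; rewrite divr_gt0.
Qed.

(** Go vertically to height top, then horizontally to the axis al = 0. *)
Lemma label_above al be : `|al| < e1 -> `|be| < e0 ->
  (forall s u, `|u - base s| < d0 -> A u = al -> B u < be) -> label (Phi al be) = nw.
Proof.
move=> al_lt be_lt below; rewrite /nw -(label_edge al_lt); last by left.
have [_ top_lt] := top_e0.
move: be_lt; rewrite ltr_norml => /andP[b1 b2].
case: (leP be top) => [|/ltW] le; [|apply/esym]; apply: label_vertical => //.
- by move=> s u nu Au; rewrite leNgt (below s u nu Au).
- by apply: lt_trans (_ : 0 < _); rewrite ?oppr_lt0 // mulr_gt0.
- by move=> s u nu Au; have /andP[_ h] := half_lt_top al_lt nu Au; rewrite leNgt h.
Qed.

Lemma label_under al be : `|al| < e1 -> `|be| < e0 ->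
  (forall s u, `|u - base s| < d0 -> A u = al -> be < B u) -> label (Phi al be) = se.
Proof.
move=> al_lt be_lt over; rewrite /se -(label_edge al_lt); last by right.
have [_ top_lt] := top_e0.
move: be_lt; rewrite ltr_norml => /andP[b1 b2].
case: (leP (- top) be) => [|/ltW] le; [apply/esym|]; apply: label_vertical => //.
- by rewrite ltrN2.
- by move=> s u nu Au; rewrite negb_and -!ltNge (over s u nu Au) orbT.
- by apply: lt_trans e0_gt0; rewrite oppr_lt0 mulr_gt0.
- by move=> s u nu Au; have /andP[h _] := half_lt_top al_lt nu Au; rewrite negb_and -!ltNge h orbT.
Qed.

(** Over al != 0 the axis be = 0 lies between the two strands; go there
    vertically. *)
Lemma label_between al be : `|al| < e1 -> al != 0 -> `|be| < e0 ->
    (forall s u, `|u - base s| < d0 -> A u = al ->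
       (0 < B u -> be < B u) /\ (B u < 0 -> B u < be)) ->
  label (Phi al be) = if al < 0 then sw else ne.
Proof.
move=> al_lt al0 be_lt btw; rewrite -label_axis //.
have B0 s u : `|u - base s| < d0 -> A u = al -> B u < 0 \/ 0 < B u.
  move=> nu Au; have := strand_sgn nu; rewrite Au.
  case: (ltgtP (B u) 0) => [|| ->]; [by left|by right|rewrite mulr0 ltxx].
  by case=> -[] // /eqP; rewrite (negPf al0).
move: be_lt; rewrite ltr_norml => /andP[b1 b2].
case: (leP be 0) => [|/ltW] le; [|apply/esym]; apply: label_vertical;
  rewrite ?oppr_lt0 // => s u nu Au; have [bp bn] := btw s u nu Au;
  rewrite negb_and -!ltNge; apply/orP;
  by case: (B0 s u nu Au) => Bu; [left|right]; auto.
Qed.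

(** Over al != 0 the two strands have different heights. *)
Lemma window_simple s u : `|u - base s| < d1 -> `|A u| < e1 -> A u != 0 -> simple u.
Proof.
move=> nu Ae Au0 u' uE; have {}uE : point u' = Phi (A u) (B u) by rewrite uE strand_coord.
have nu0 := lt_le_trans nu d10.
have Be : `|B u| < e0.
  by apply: lt_trans (small nu).2 _; rewrite ltr_pdivrMr // ltr_pMr // ltr1n.
have [s' [k ku]] := box (lt_e0 Ae) Be uE.
exists k; rewrite -[LHS](subrK k%:~R).
move: uE; rewrite -(point_shift _ _ (- k)) mulrNz strand_coord => /Phi_inj [EA EB].
by rewrite (strand_disjoint nu0 ku).
Qed.

Lemma window_germ s u e X : simple u -> `|u - base s| < d0 ->
    (exists2 d, 0 < d & forall h, 0 < h < d -> label (Phi (A u) (B u + sgn R e * h)) = X) ->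
  germ e u (normal u) = X.
Proof.
move=> su nu [eps eps0 labX]; rewrite -(germ_side e su (transverse nu)).
apply: (germE eps0) => h hd; rewrite -(labX h hd); congr (label _).
by rewrite -displace_Phi -strand_coord.
Qed.

Lemma window_column s u s' u' : `|u - base s| < d0 -> `|u' - base s'| < d0 ->
    A u != 0 -> A u' = A u -> u' = u \/ (0 < B u /\ B u' < 0) \/ (B u < 0 /\ 0 < B u').
Proof.
move=> nu nu' Au0 EA; have [sE|s's] := eqVneq s' s.
  by left; apply: (strand_inj (s := s)) => //; rewrite -sE.
right; have := strand_sgn nu; have := strand_sgn nu'; rewrite EA (sgnN s's).
move: Au0 => /eqP; rewrite /sgn; move: (A u) (B u) (B u') => x y z x0.
by case: (s); case=> [[? ?]|[? ?]|[]] // [[? ?]|[? ?]|[]] //; lra.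
Qed.

(** A strand passes from one side of the other strand to the opposite side at
    the crossing; on which side it is at time u is told by the sign of B u. *)
Lemma window_side s u : `|u - base s| < d1 -> `|A u| < e1 -> u != base s ->
  simple u /\ side u = if s then (if u < b then (sw, se) else (nw, ne))
                       else (if u < a then (nw, sw) else (ne, se)).
Proof.
move=> nu Ae ub; have nu0 := lt_le_trans nu d10.
have [_ Be0] := small nu.
have Be e h : 0 < h < `|B u| -> `|B u + sgn R e * h| < e0.
  move=> /andP[h0 hB]; apply: le_lt_trans (ler_normD _ _) _.
  by rewrite sgn_abs (gtr0_norm h0) [ltRHS]splitr ltrD // (lt_trans hB).
have Au0 : A u != 0.
  case: (ltgtP u (base s)) ub => // lt _.
    by have [lt0 _] := strand_before nu0 lt; rewrite lt_eqF.
  by have [gt0 _] := strand_after nu0 lt; rewrite gt_eqF.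
have su := window_simple nu Ae Au0.
have up : 0 < B u -> side u = (nw, if A u < 0 then sw else ne).
  move=> B0; congr (_, _); apply: (window_germ su nu0); exists `|B u|;
    rewrite ?normr_gt0 ?gt_eqF // => h hB.
    apply: label_above; rewrite ?Be // => s' u' nu' EA.
    rewrite /sgn mul1r; have /andP[h0 _] := hB.
    by case: (window_column nu0 nu' Au0 EA) => [->|]; lra.
  apply: label_between; rewrite ?Be // => s' u' nu' EA.
  move: hB; rewrite /sgn mulN1r gtr0_norm // => /andP[h0 hB].
  by case: (window_column nu0 nu' Au0 EA) => [->|]; split; lra.
have down : B u < 0 -> side u = (if A u < 0 then sw else ne, se).
  move=> B0; congr (_, _); apply: (window_germ su nu0); exists `|B u|;
    rewrite ?normr_gt0 ?lt_eqF // => h hB.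
    apply: label_between; rewrite ?Be // => s' u' nu' EA.
    move: hB; rewrite /sgn mul1r ltr0_norm // => /andP[h0 hB].
    by case: (window_column nu0 nu' Au0 EA) => [->|]; split; lra.
  apply: label_under; rewrite ?Be // => s' u' nu' EA.
  rewrite /sgn mulN1r; have /andP[h0 _] := hB.
  by case: (window_column nu0 nu' Au0 EA) => [->|]; lra.
split=> //; case: (ltgtP u (base s)) ub => // lt _.
  have [A0 B0] := strand_before nu0 lt; rewrite A0 in up down.
  case: s lt B0 {nu nu0 Be Be0} => /= lt; rewrite lt /sgn.
    by rewrite mulN1r oppr_gt0.
  by rewrite mul1r.
have [A0 B0] := strand_after nu0 lt; rewrite (lt_gtF A0) in up down.
case: s lt B0 {nu nu0 Be Be0} => /= lt; rewrite (lt_gtF lt) /sgn.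
  by rewrite mulN1r oppr_lt0.
by rewrite mul1r.
Qed.

Lemma window_labels al be : `|al| < e1 -> `|be| < e0 -> ~ range point (Phi al be) ->
  label (Phi al be) \in [:: nw; sw; se; ne].
Proof.
move=> al_lt be_lt off; rewrite !inE.
have [ua nua Aua] := ivt false al_lt; have [ub nub Aub] := ivt true al_lt.
have nua0 := lt_le_trans nua d10; have nub0 := lt_le_trans nub d10.
have column s u : `|u - base s| < d0 -> A u = al -> B u = B ua \/ B u = B ub.
  move=> nu Au; case: s nu => nu; [right|left].
    by rewrite (strand_inj (s := true) nu nub0) // Au.
  by rewrite (strand_inj (s := false) nu nua0) // Au.
have neq s u : `|u - base s| < d0 -> A u = al -> B u <> be.
  by move=> nu Au Bu; apply: off; exists u => //; rewrite strand_coord Au Bu.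
have := neq false ua nua0 Aua; have := neq true ub nub0 Aub.
have sa := strand_sgn nua0; have sb := strand_sgn nub0.
rewrite Aua /sgn mul1r in sa; rewrite Aub /sgn mulN1r oppr_gt0 oppr_lt0 in sb.
have [lt_ab lt_ba] := opposite_slopes sa sb.
case: (ltgtP (B ua) be) => [a_lt|a_gt|//]; case: (ltgtP (B ub) be) => [b_lt|b_gt|//] _ _.
- rewrite (label_above al_lt be_lt) ?eqxx // => s u nu Au.
  by case: (column s u nu Au) => ->.
- have [al_gt an bp] := lt_ab (lt_trans a_lt b_gt).
  have al0 : al != 0 by rewrite gt_eqF.
  rewrite (label_between al_lt al0 be_lt) => [|s u nu Au].
    by rewrite (lt_gtF al_gt) eqxx !orbT.
  by case: (column s u nu Au) => ->; split => // h; [move: (lt_trans h an)|move: (lt_trans h bp)];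
    rewrite ltxx.
- have [al_neg bn ap] := lt_ba (lt_trans b_lt a_gt).
  have al0 : al != 0 by rewrite lt_eqF.
  rewrite (label_between al_lt al0 be_lt) => [|s u nu Au].
    by rewrite al_neg eqxx !orbT.
  by case: (column s u nu Au) => ->; split => // h; [move: (lt_trans h ap)|move: (lt_trans h bn)];
    rewrite ltxx.
- rewrite (label_under al_lt be_lt) ?eqxx ?orbT // => s u nu Au.
  by case: (column s u nu Au) => ->.
Qed.

End Window.

(** A vertical line over al < 0 meets the regions nw, sw, se from top to bottom
    and one over al > 0 meets nw, ne, se. *)
Lemma two_strands : exists nw sw se ne : 'I_n.+2,
  (exists2 d, 0 < d & forall s u, `|u - base s| < d -> u != base s ->
    simple u /\ side u = if s then (if u < b then (sw, se) else (nw, ne))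
                         else (if u < a then (nw, sw) else (ne, se))) /\
  \forall z \near point a, ~ range point z -> label z \in [:: nw; sw; se; ne].
Proof.
have [d0 [e0 [d1 [e1 [[e1_gt0 e10 d1_gt0 d10] [transverse mono box small ivt]]]]]] :=
  local_model.
do 4 eexists; split.
  have [d2 d2_gt0 small2] := strand_small e1_gt0.
  exists (Num.min d1 d2) => [|s u]; first by rewrite lt_min d1_gt0.
  rewrite lt_min => /andP[u1 /small2 [Ae _]] ub.
  exact: (window_side e1_gt0 e10 d1_gt0 d10 transverse mono box small ivt u1 Ae ub).
have near0 (f : R * R -> R) e : continuous f -> f P = 0 -> 0 < e ->
    \forall z \near P, `|f z| < e.
  move=> cf f0 e_gt0.
  have nf : \forall z \near P, ball (f P) e (f z) by exact: (cf P _ (nbhsx_ballx _ _ e_gt0)).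
  by apply: filterS nf => z; rewrite f0 -ball_normE /= sub0r normrN.
have e0_gt0 := lt_le_trans e1_gt0 e10.
have cc := @continuous_crossl R.
have nA := near0 (fun z => (cross z w - cross P w) / (2 * c)) e1 _ _ e1_gt0.
have nB := near0 (fun z => (cross P q - cross z q) / (2 * c)) e0 _ _ e0_gt0.
apply: filterS2 (nA _ _) (nB _ _) => [z zA zB off|z||z|].
- rewrite (Phi_coord z) in off *.
  exact: (window_labels e1_gt0 e10 d1_gt0 d10 mono box small ivt zA zB off).
- by apply: cvgM; [apply: cvgB; [exact: cc|exact: cvg_cst]|exact: cvg_cst].
- by rewrite subrr mul0r.
- by apply: cvgM; [apply: cvgB; [exact: cvg_cst|exact: cc]|exact: cvg_cst].
- by rewrite subrr mul0r.
Qed.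
End Strands.

(** * The diagram of a curve *)

Section Sides.
Variables (R : realType) (n : nat) (C : labelled_curve R n).
Local Notation point := (curve_point C).
Local Notation velocity := (velocity C).
Local Notation ctime := (crossing_time C).
Local Notation label := (label C).
Local Notation simple := (simple_time C).
Local Notation side := (curve_side C).
Local Notation germ := (curve_germ C).
Local Notation normal := (curve_normal C).
Implicit Types (s : bool) (i : 'I_n) (t u : R) (k : int).

Lemma side_shift t k : side (t + k%:~R) = side t.
Proof.
have velE : velocity (t + k%:~R) = velocity t by apply: loop_shift; exact: velocity_periodic.
by rewrite /curve_side /curve_germ /curve_normal velE point_shift.
Qed.

Lemma simple_shift t k : simple t -> simple (t + k%:~R).
Proof.
move=> st u; rewrite point_shift => /st [k' ->]; exists (k' - k).
by rewrite -addrA -intrD (addrC k) subrK.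
Qed.

(** Times near t0 are determined by [cross (point _) (normal t0)], and points
    near that of t0 are reached only at such times. *)
Lemma simple_near t0 : simple t0 ->
  exists2 d, 0 < d & forall t, `|t - t0| < d -> simple t.
Proof.
move=> st0; have [d1 d1_gt0 pos] := cross_box (normal_pos C t0).
have [d2 d2_gt0 near2] := box_near (normal t0) (fiber_near C t0 d1_gt0).
exists (Num.min d1 d2) => [|t]; first by rewrite lt_min d1_gt0.
rewrite lt_min => /andP[t1 t2] u uE.
have [||||u0 [/st0 [k ->] ku]] := near2 t 0 (normal t0) t2 _ _ _ u.
- by rewrite normr0.
- by rewrite subrr normr0.
- by rewrite subrr normr0.
- by rewrite displace0.
exists k; rewrite -[LHS](subrK k%:~R); congr (_ + _).
apply: (inj_near (fun x xd => pos x (normal t0) xd _ _) _ t1).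
- by rewrite subrr normr0.
- by rewrite subrr normr0.
- by rewrite -addrA -opprD [k%:~R + _]addrC.
- by rewrite -uE -[in RHS](subrK k%:~R u) point_shift.
Qed.

Lemma time_shift_inj s i s' i' k : ctime s i = ctime s' i' + k%:~R ->
  [/\ k = 0, s = s' & i = i'].
Proof.
move=> E; have k0 : k = 0.
  have := crossing_time_ge0 C s i; have := crossing_time_lt1 C s i.
  have := crossing_time_ge0 C s' i'; have := crossing_time_lt1 C s' i'.
  rewrite E => c1 c2 c3 c4; case: (ltgtP k 0) => // k0; exfalso.
    have : (k%:~R : R) <= -1 by rewrite -[-1]/((-1)%:~R) ler_int; move: k0; clear; lia.
    by lra.
  have : 1 <= (k%:~R : R) by rewrite ler1z.
  by lra.
by move: E; rewrite k0 addr0 => /crossing_time_inj [-> ->].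
Qed.

Lemma crossing_fiber i u : point u = point (ctime false i) ->
  exists k : int, u = ctime false i + k%:~R \/ u = ctime true i + k%:~R.
Proof.
move=> /double_point [[k ->]|[s [j [k [k' [-> E]]]]]]; first by exists k; left.
have [_ sE iE] := time_shift_inj E; exists k; right.
by rewrite iE -[s]negbK -sE.
Qed.

Lemma simple_or_crossing t : simple t \/ exists s i k, t = ctime s i + k%:~R.
Proof.
have [cr|ncr] := pselect (exists s i k, t = ctime s i + k%:~R); [by right|left].
move=> u /double_point [[k ->]|[s [j [k [k' [_ tE]]]]]]; first by exists k.
by case: ncr; exists (~~ s), j, k'.
Qed.

Definition corners_spec i (x : 'I_n.+2 * 'I_n.+2 * ('I_n.+2 * 'I_n.+2)) :=
  let: (nw, sw, (se, ne)) := x in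
  (exists2 d, 0 < d & forall s u, `|u - ctime s i| < d -> u != ctime s i ->
    simple u /\ side u = if s then (if u < ctime true i then (sw, se) else (nw, ne))
                         else (if u < ctime false i then (nw, sw) else (ne, se))) /\
  \forall z \near point (ctime false i), ~ range point z -> label z \in [:: nw; sw; se; ne].

Lemma exists_corners : exists x, forall i, corners_spec i (x i).
Proof.
have /fin_all_exists [x xP] i : exists y, corners_spec i y; last by exists x.
have [nw [sw [se [ne [[d d0 dP] nz]]]]] :=
  two_strands (crossing_point C i) (@crossing_fiber i) (crossing_positive C i).
by exists (nw, sw, (se, ne)); split => //; exists d => // -[] u; [exact: (dP true)|exact: (dP false)].
Qed.

Definition before_side t : 'I_n.+2 * 'I_n.+2 :=
  xget (ord0, ord0) [set A | exists2 d, 0 < d & forall u, t - d < u < t -> side u = A].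

Definition after_side t : 'I_n.+2 * 'I_n.+2 :=
  xget (ord0, ord0) [set A | exists2 d, 0 < d & forall u, t < u < t + d -> side u = A].

Lemma beforeE t d A : 0 < d -> (forall u, t - d < u < t -> side u = A) -> before_side t = A.
Proof.
move=> d0 sA; apply: xget_unique => [|B [d' d'0 sB]]; first by exists d.
have [u u1 u2] : exists2 u, t - d < u < t & t - d' < u < t.
  by exists (t - Num.min d d' / 2); case: (ltP d d') => ?; apply/andP; split; lra.
by rewrite -(sA u u1) sB.
Qed.

Lemma afterE t d A : 0 < d -> (forall u, t < u < t + d -> side u = A) -> after_side t = A.
Proof.
move=> d0 sA; apply: xget_unique => [|B [d' d'0 sB]]; first by exists d.
have [u u1 u2] : exists2 u, t < u < t + d & t < u < t + d'.
  by exists (t + Num.min d d' / 2); case: (ltP d d') => ?; apply/andP; split; lra.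
by rewrite -(sA u u1) sB.
Qed.

Lemma simple_sides t : simple t -> before_side t = side t /\ after_side t = side t.
Proof.
move=> st; have /nbhs_ballP [d /= d0 dP] := side_near st.
by split; [apply: (beforeE d0)|apply: (afterE d0)] => u /andP[u1 u2]; apply: dP;
  rewrite -ball_normE /= ltr_norml; apply/andP; split; lra.
Qed.

Lemma sides_near t : exists2 d, 0 < d & forall u,
  (t - d < u < t -> simple u /\ side u = before_side t) /\
  (t < u < t + d -> simple u /\ side u = after_side t).
Proof.
case: (simple_or_crossing t) => [st|[s [i [k tE]]]].
  have [sb sa] := simple_sides st; have [d1 d1_gt0 simp] := simple_near st.
  have /nbhs_ballP [d2 /= d2_gt0 dP] := side_near st.
  exists (Num.min d1 d2) => [|u]; first by rewrite lt_min d1_gt0.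
  have close : `|u - t| < Num.min d1 d2 -> simple u /\ side u = side t.
    rewrite lt_min => /andP[u1 u2]; split; first exact: simp.
    by apply: dP; rewrite -ball_normE /= distrC.
  by rewrite sb sa; split => /andP[u1 u2]; apply: close; rewrite ltr_norml; apply/andP; split; lra.
have [x /(_ i)] := exists_corners.
case: (x i) => -[nw sw] [se ne] [[d d0 dP] _].
pose lft := if s then (sw, se) else (nw, sw).
pose rgt := if s then (nw, ne) else (ne, se).
have sideE u : (t - d < u < t -> simple u /\ side u = lft) /\
    (t < u < t + d -> simple u /\ side u = rgt).
  rewrite tE; have := dP s (u - k%:~R); rewrite -(side_shift _ k) subrK.
  move=> dPu; split=> /andP[u1 u2].
    have lt : u - k%:~R < ctime s i by lra.
    have [||simp ->] := dPu; rewrite ?lt_eqF //.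
      by rewrite ltr_norml; apply/andP; split; lra.
    split; first by rewrite -[u](subrK k%:~R); exact: simple_shift.
    by rewrite /lft; case: (s) lt => lt; rewrite lt.
  have lt : ctime s i < u - k%:~R by lra.
  have [||simp ->] := dPu; rewrite ?gt_eqF //.
    by rewrite ltr_norml; apply/andP; split; lra.
  split; first by rewrite -[u](subrK k%:~R); exact: simple_shift.
  by rewrite /rgt; case: (s) lt => lt; rewrite lt_gtF.
rewrite (beforeE d0 (fun u h => ((sideE u).1 h).2)).
by rewrite (afterE d0 (fun u h => ((sideE u).2 h).2)); exists d.
Qed.

(** On the interval, the values of F before t, completed by the value after p
    at its left end, form a locally constant function. *)
Lemma sides_travel_curve (V : Type) (F : 'I_n.+2 * 'I_n.+2 -> V) (p q : R) :
  p < q -> (forall t, p < t < q -> F (before_side t) = F (after_side t)) ->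
  F (after_side p) = F (before_side q).
Proof.
move=> pq crossF.
pose f t := if t <= p then F (after_side p) else if q <= t then F (before_side q) else F (before_side t).
suff : f p = f q by rewrite /f lexx leNgt pq lexx.
have near_before t : exists2 d, 0 < d & forall u,
    (t - d < u < t -> before_side u = before_side t) /\ (t < u < t + d -> before_side u = after_side t).
  have [d d0 dP] := sides_near t; exists d => // u; have [h1 h2] := dP u.
  by split=> [/h1|/h2] [/simple_sides [-> _]].
apply: locally_constant_itv (ltW pq) _ => t /andP[pt tq].
have [d d0 dP] := near_before t.
have := pt; rewrite le_eqVlt => /orP[/eqP tE|{}pt].
  apply/nbhs_ballP; exists (Num.min d (q - p)) => [|u]; first by rewrite /= lt_min d0 subr_gt0.
  rewrite -ball_normE /= lt_min !ltr_norml -tE => /andP[/andP[u1 u2] /andP[u3 u4]].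
  rewrite /f lexx; case: ifPn => //; rewrite -ltNge => pu.
  have uq : u < q by lra.
  rewrite (lt_geF uq).
  by rewrite (dP u).2 ?tE //; apply/andP; split; lra.
have := tq; rewrite le_eqVlt => /orP[/eqP tE|{}tq].
  apply/nbhs_ballP; exists (Num.min d (q - p)) => [|u]; first by rewrite /= lt_min d0 subr_gt0.
  rewrite -ball_normE /= lt_min !ltr_norml tE => /andP[/andP[u1 u2] /andP[u3 u4]].
  have pu : p < u by lra.
  rewrite /f (lt_geF pq) lexx (lt_geF pu).
  case: ifPn => //; rewrite -ltNge => uq.
  by rewrite (dP u).1 ?tE //; apply/andP; split; lra.
apply/nbhs_ballP; exists (Num.min d (Num.min (t - p) (q - t))) => [|u].
  by rewrite /= !lt_min d0 !subr_gt0 pt.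
rewrite -ball_normE /= !lt_min !ltr_norml.
move=> /andP[/andP[u1 u2] /andP[/andP[u3 u4] /andP[u5 u6]]].
have pu : p < u by lra.
have uq : u < q by lra.
rewrite /f (lt_geF pu) (lt_geF uq) (lt_geF pt) (lt_geF tq).
case: (ltgtP u t) => [ut|tu|-> //].
  by rewrite (dP u).1 //; apply/andP; split; lra.
rewrite (dP u).2 ?crossF ?pt //; apply/andP; split; lra.
Qed.

(** By the intermediate value theorem, a point near the curve is obtained from
    a point of the curve by displacement along the normal direction at t. *)
Lemma labels_near_simple t : simple t -> \forall z \near point t,
  ~ range point z -> label z = (side t).1 \/ label z = (side t).2.
Proof.
move=> st; have pos := normal_pos C t.
set w := normal t in pos *; set v := velocity t in pos *; set D := cross v w in pos *.
have [d1 d1_gt0 labl] := germ_box false st pos.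
have [d2 d2_gt0 labr] := germ_box true st pos.
have [d3 d3_gt0 posw] := cross_box pos.
pose d := Num.min d1 (Num.min d2 d3).
have d_gt0 : 0 < d by rewrite !lt_min d1_gt0 d2_gt0.
have eps_gt0 : 0 < d * D / 2 by rewrite divr_gt0 // mulr_gt0.
have near_v (p : R * R) : \forall z \near p, `|cross p v - cross z v| < d * D / 2.
  by have := @continuous_crossl R v p _ (nbhsx_ballx _ _ eps_gt0); rewrite -ball_normE.
have near_u : \forall u \near t, `|cross (point t) v - cross (point u) v| < d * D / 2.
  exact: (continuous_point (C := C) (near_v (point t))).
have /nbhs_ballP [d4 /= d4_gt0 small] := near_u.
pose e := Num.min d d4 / 2.
have e_gt0 : 0 < e by rewrite divr_gt0 // lt_min d_gt0.
have [ed ed4] : e < d /\ e < d4.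
  by rewrite /e; case: (ltP d d4) => ?; split; lra.
have posd u : `|u - t| < d -> 0 < cross (velocity u) w.
  by rewrite !lt_min => /and3P[_ _ ud]; apply: posw; rewrite // subrr normr0.
have incr := incr_near posd.
have Fl : cross (point (t - e)) w < cross (point t) w.
  by apply: incr; rewrite ?subrr ?normr0 // ?ltr_norml; [apply/andP; split; lra|lra].
have Fr : cross (point t) w < cross (point (t + e)) w.
  by apply: incr; rewrite ?subrr ?normr0 // ?ltr_norml; [apply/andP; split; lra|lra].
pose eta := Num.min (cross (point t) w - cross (point (t - e)) w)
                    (cross (point (t + e)) w - cross (point t) w).
have eta_gt0 : 0 < eta by rewrite lt_min !subr_gt0 Fl.
have near_w : \forall z \near point t, `|cross (point t) w - cross z w| < eta.
  by have := @continuous_crossl R w (point t) _ (nbhsx_ballx _ _ eta_gt0); rewrite -ball_normE.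
apply: filterS2 near_w (near_v (point t)) => z zw zv off.
move: zw; rewrite lt_min !ltr_norml => /andP[/andP[z1 z2] /andP[z3 z4]].
have [||| u] := @IVT R (fun u => cross (point u) w) (t - e) (t + e) (cross z w).
- by lra.
- by apply: continuous_subspaceT; exact: continuous_cross.
- by rewrite ge_min le_max; apply/andP; split; apply/orP; [left|right]; lra.
rewrite in_itv /= => /andP[u1 u2] uE.
have ue : `|u - t| <= e by rewrite ler_norml; apply/andP; split; lra.
have uv : `|cross (point t) v - cross (point u) v| < d * D / 2.
  by apply: small; rewrite -ball_normE /= distrC (le_lt_trans ue).
have zE := displace_solve (lt0r_neq0 pos) (esym uE).
set h := (_ / _) in zE.
have hd : `|h| < d.
  rewrite /h -/D normrM normfV (gtr0_norm pos) ltr_pdivrMr //.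
  have -> : cross (point u) v - cross z v =
    (cross (point t) v - cross z v) - (cross (point t) v - cross (point u) v) by ring.
  by apply: le_lt_trans (ler_normB _ _) _; lra.
have ud := le_lt_trans ue ed.
move: ud hd; rewrite !lt_min => /and3P[ud1 ud2 ud3] /and3P[hd1 hd2 _].
(* z is the point of the curve at time u displaced by h along w. *)
case: (ltgtP h 0) => [h0|h0|h0].
- right; rewrite /curve_side /= -[normal t]/w.
  have [||| _ labE] := labr u w; rewrite ?subrr ?normr0 //.
  have := labE (- h); rewrite /sgn mulN1r opprK -zE; apply.
  by rewrite oppr_gt0 h0 -normrN gtr0_norm ?oppr_gt0 in hd2 *.
- left; rewrite /curve_side /= -[normal t]/w.
  have [||| _ labE] := labl u w; rewrite ?subrr ?normr0 //.
  have := labE h; rewrite /sgn mul1r -zE; apply.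
  by rewrite h0 gtr0_norm in hd1 *.
by case: off; exists u => //; rewrite zE h0 displace0.
Qed.

Lemma side_adherent u e (U : R * R -> Prop) : simple u -> (\forall z \near point u, U z) ->
  exists z, [/\ U z, ~ range point z & label z = germ e u (normal u)].
Proof.
move=> su nU; have pos := normal_pos C u.
have [d1 d1_gt0 off] := off_curve_near su pos.
have [d2 d2_gt0 inU] := box_near (normal u) (P := U) nU.
have [d3 d3_gt0 labE] := germ_box e su pos.
pose h := Num.min d1 (Num.min d2 d3) / 2.
have [h0 [h1 [h2 h3]]] : 0 < h /\ h < d1 /\ h < d2 /\ h < d3.
  have m0 : 0 < Num.min d1 (Num.min d2 d3) by rewrite !lt_min d1_gt0 d2_gt0.
  have : h < Num.min d1 (Num.min d2 d3) by rewrite ltr_pdivrMr // ltr_pMr // ltr1n.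
  by rewrite !lt_min => /and3P[]; rewrite divr_gt0.
have absh : `|sgn R e * h| = h by rewrite sgn_abs gtr0_norm.
exists (displace (point u) (sgn R e * h) (normal u)); split.
- by apply: inU; rewrite ?subrr ?normr0 ?absh.
- apply: off; rewrite ?subrr ?normr0 ?absh //.
  by rewrite -normr_gt0 absh.
- by have [||| _ ->] := labE u (normal u); rewrite ?subrr ?normr0 ?h0.
Qed.

(** Close to every time there are simple times, and next to the curve at a
    simple time there are points off the curve. *)
Lemma off_curve_dense (z : R * R) (U : R * R -> Prop) : (\forall z1 \near z, U z1) -> exists2 z', U z' & ~ range point z'.
Proof.
move=> nU; have [[t _ tz]|off] := pselect (range point z); last first.
  by exists z => //; exact: nbhs_singleton.
rewrite -tz in nU; have nUt : \forall u \near t, \forall z \near point u, U z.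
  exact: (continuous_point (C := C) (near_join nU)).
have /nbhs_ballP [d /= d0 dP] := nUt.
have [d1 d1_gt0 sides] := sides_near t.
pose u := t + Num.min d d1 / 2.
have [m0 [md md1]] : 0 < Num.min d d1 / 2 /\ Num.min d d1 / 2 < d /\ Num.min d d1 / 2 < d1.
  by case: (ltP d d1) => ?; split; try split; lra.
have su : simple u by apply: ((sides u).2 _).1; rewrite /u; apply/andP; split; lra.
have nUu : \forall z \near point u, U z.
  by apply: dP; rewrite -ball_normE /= /u opprD addrA subrr sub0r normrN gtr0_norm.
have [z' [Uz' off _]] := side_adherent false su nUu.
by exists z'.
Qed.

(** Around every point of the plane the labels that occur have the same image
    under f: there is one label off the curve, there are two at a simple time
    and four at a crossing. So f of the label extends to a locally constant
    function on the plane, which is constant along segments. *)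
Lemma sides_connect_curve (V : Type) (f : 'I_n.+2 -> V) :
    (forall t, f (before_side t).1 = f (before_side t).2 /\ f (after_side t).1 = f (after_side t).2) ->
  forall j j', f j = f j'.
Proof.
move=> fsides.
have local (z : R * R) : exists A, \forall z' \near z, ~ range point z' -> f (label z') = A.
  have [[t _ <-]|off] := pselect (range point z); last first.
    exists (f (label z)); have := label_locally_constant off.
    by apply: filterS => z' -> _.
  case: (simple_or_crossing t) => [st|[s [i [k tE]]]].
    exists (f (side t).1); have [sb _] := simple_sides st.
    have := fsides t; rewrite sb => -[fE _].
    by apply: filterS (labels_near_simple st) => z' zP /zP[] -> //; rewrite fE.
  have [x /(_ i)] := exists_corners.
  have -> : point t = point (ctime false i).
    by rewrite tE point_shift; case: (s); rewrite ?crossing_point.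
  case: (x i) => -[nw sw] [se ne] [[d d0 dP] near4]; exists (f nw).
  have sideb s' : before_side (ctime s' i) = if s' then (sw, se) else (nw, sw).
    apply: (beforeE d0) => u /andP[u1 u2]; have [||_ ->] := dP s' u.
    - by rewrite ltr_norml; apply/andP; split; lra.
    - by rewrite lt_eqF.
    by case: s' u1 u2 => _ u2; rewrite u2.
  have sidea : after_side (ctime false i) = (ne, se).
    apply: (afterE d0) => u /andP[u1 u2]; have [||_ ->] := dP false u.
    - by rewrite ltr_norml; apply/andP; split; lra.
    - by rewrite gt_eqF.
    by rewrite lt_gtF.
  have [f1 fa] := fsides (ctime false i); have [f2 _] := fsides (ctime true i).
  move: f1 fa f2; rewrite !sideb sidea /= => f1 fa f2.
  apply: filterS near4 => z' zP /zP; rewrite !inE.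
  by case/or4P => /eqP ->; rewrite ?fa ?f1 ?f2.
move=> j j'.
have [z0 [off0 <-]] := label_onto C j; have [z1 [off1 <-]] := label_onto C j'.
pose Q (z : R * R) := \forall z' \near z, ~ range point z' -> f (label z') = f (label z0).
have nearlab (z : R * R) : ~ range point z -> \forall z' \near z, ~ range point z' -> f (label z') = f (label z).
  by move=> off; apply: filterS (label_locally_constant off) => z' ->.
pose c := segment z0 z1.
have c0 : c 0 = z0 by exact: segment0.
have c1 : c 1 = z1 by exact: segment1.
have cc : continuous c by exact: continuous_segment.
(* Density of the complement makes the common value near z unique. *)
have Qloc (z : R * R) : \forall z' \near z, Q z' = Q z.
  have [A nzA] := local z; have nA := near_join nzA.
  apply: filterS nA => z' nA'.
  have QA (z2 : R * R) : (\forall z' \near z2, ~ range point z' -> f (label z') = A) ->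
      Q z2 = (A = f (label z0)).
    move=> nA2; apply/propext; split=> [Qz|AE]; last by move: nA2; rewrite AE.
    have [z3 [h1 h2] off] := off_curve_dense (filterI nA2 Qz).
    by rewrite -(h1 off) (h2 off).
  by rewrite (QA z' nA') (QA z nzA).
have E : Q (c 0) = Q (c 1).
  apply: (locally_constant_itv (f := fun x => Q (c x)) ler01) => x _.
  exact: (cc x _ (Qloc (c x))).
have : Q z1 by rewrite -c1 -E c0; exact: nearlab.
by move=> /nbhs_singleton /(_ off1).
Qed.

(** The corners of a crossing are characterized by adherence, which is what the
    region choice matrix is about. *)
Theorem diagram_of_curve : exists K : knot_diagram R n,
  forall i j, corner K i j <->
    forall U : R * R -> Prop, (\forall z \near point (ctime false i), U z) ->
      exists z, [/\ U z, ~ range point z & label z = j].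
Proof.
have [x xP] := exists_corners.
pose nw i := (x i).1.1; pose sw i := (x i).1.2.
pose se i := (x i).2.1; pose ne i := (x i).2.2.
have corners i : (exists2 d, 0 < d & forall s u, `|u - ctime s i| < d -> u != ctime s i ->
    simple u /\ side u = if s then (if u < ctime true i then (sw i, se i) else (nw i, ne i))
                         else (if u < ctime false i then (nw i, sw i) else (ne i, se i))) /\
    \forall z \near point (ctime false i), ~ range point z ->
      label z \in [:: nw i; sw i; se i; ne i].
  by have := xP i; rewrite /nw /sw /se /ne; case: (x i) => -[? ?] [? ?].
have beforeC s i : before_side (ctime s i) = if s then (sw i, se i) else (nw i, sw i).
  have [[d d0 dP] _] := corners i.
  apply: (beforeE d0) => u /andP[u1 u2]; have [||_ ->] := dP s u.
  - by rewrite ltr_norml; apply/andP; split; lra.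
  - by rewrite lt_eqF.
  by case: s u1 u2 => _ u2; rewrite u2.
have afterC s i : after_side (ctime s i) = if s then (nw i, ne i) else (ne i, se i).
  have [[d d0 dP] _] := corners i.
  apply: (afterE d0) => u /andP[u1 u2]; have [||_ ->] := dP s u.
  - by rewrite ltr_norml; apply/andP; split; lra.
  - by rewrite gt_eqF.
  by case: s u1 u2 => u1 _; rewrite lt_gtF.
have periodic t : before_side (t + 1) = before_side t /\ after_side (t + 1) = after_side t.
  have [d d0 dP] := sides_near t; split.
    apply: (beforeE d0) => u /andP[u1 u2].
    rewrite -[u](subrK 1) (side_shift _ 1); apply: ((dP _).1 _).2.
    by apply/andP; split; lra.
  apply: (afterE d0) => u /andP[u1 u2].
  rewrite -[u](subrK 1) (side_shift _ 1); apply: ((dP _).2 _).2.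
  by apply/andP; split; lra.
have smooth t : (exists s i k, t = ctime s i + k%:~R) \/ before_side t = after_side t.
  case: (simple_or_crossing t) => [st|]; last by left.
  by right; have [-> ->] := simple_sides st.
exists (KnotDiagram periodic (crossing_time_ge0 C) (crossing_time_lt1 C) (@crossing_time_inj _ _ C)
  (fun i => conj (beforeC false i) (afterC false i))
  (fun i => conj (beforeC true i) (afterC true i)) smooth sides_travel_curve sides_connect_curve).
move=> i j; rewrite /corner /=; split=> [|adh]; last first.
  by have [z [zP off <-]] := adh _ (corners i).2; exact: zP.
move=> jc U nU.
have [[d d0 dP] _] := corners i.
have nUt : \forall u \near ctime false i, \forall z \near point u, U z.
  exact: (continuous_point (C := C) (near_join nU)).
have /nbhs_ballP [d1 /= d1_gt0 nUd] := nUt.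
have [e [e0 ed ed1]] : exists e, [/\ 0 < e, e < d & e < d1].
  by exists (Num.min d d1 / 2); case: (ltP d d1) => ?; split; lra.
have adh e' u : `|u - ctime false i| = e -> u != ctime false i ->
    exists z, [/\ U z, ~ range point z & label z = germ e' u (normal u)].
  move=> ue un; have [||su _] := dP false u; rewrite ?ue //.
  by apply: side_adherent => //; apply: nUd; rewrite -ball_normE /= distrC ue.
have sideL : side (ctime false i - e) = (nw i, sw i).
  have [||_ ->] := dP false (ctime false i - e).
  - by rewrite addrAC subrr sub0r normrN gtr0_norm.
  - by rewrite lt_eqF // ltrBlDr ltrDl.
  by rewrite ltrBlDr ltrDl e0.
have sideR : side (ctime false i + e) = (ne i, se i).
  have [||_ ->] := dP false (ctime false i + e).
  - by rewrite addrAC subrr add0r gtr0_norm.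
  - by rewrite gt_eqF // ltrDl.
  by rewrite lt_gtF // ltrDl.
have adhL e' := adh e' (ctime false i - e).
have adhR e' := adh e' (ctime false i + e).
rewrite addrAC subrr sub0r normrN gtr0_norm // lt_eqF ?ltrBlDr ?ltrDl // in adhL.
rewrite addrAC subrr add0r gtr0_norm // gt_eqF ?ltrDl // in adhR.
move: jc sideL sideR; rewrite /curve_side !inE => jc [l1 l2] [r1 r2].
have := adhL false erefl isT; have := adhL true erefl isT.
have := adhR false erefl isT; have := adhR true erefl isT.
by rewrite l1 l2 r1 r2; case/or4P: jc => /eqP ->.
Qed.
End Sides.

(** * From the surface to the plane *)

(** An injective parametrization by the plane of a part of M that contains the
    curve. On the sphere a point is missing; it belongs to a region, and
    [chart_regions] asks that every region be visible. The chain rule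
    [chart_chain] carries regularity and transversality from space to the
    plane. *)
Record chart (R : realType) (M : set 'rV[R]_3) (D : set 'rV[R]_3) (g : R -> 'rV[R]_3) := Chart {
  chart_map : R * R -> 'rV[R]_3;
  chart_point : R -> R * R;
  chart_velocity : R -> R * R;
  chart_partial1 : R * R -> 'rV[R]_3;
  chart_partial2 : R * R -> 'rV[R]_3;
  chart_continuous : continuous chart_map;
  chart_in : forall z, M (chart_map z);
  chart_inj : injective chart_map;
  chart_mapK : forall t, chart_map (chart_point t) = g t;
  chart_derive1 : forall t : R, is_derive t (1 : R) (fun u : R => (chart_point u).1 : R) (chart_velocity t).1;
  chart_derive2 : forall t : R, is_derive t (1 : R) (fun u : R => (chart_point u).2 : R) (chart_velocity t).2;
  chart_C1 : continuous chart_velocity;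
  chart_chain : forall t, derive1 g t =
    (chart_velocity t).1 *: chart_partial1 (chart_point t) +
    (chart_velocity t).2 *: chart_partial2 (chart_point t);
  chart_open : forall (z : R * R) (U : R * R -> Prop), (\forall z' \near z, U z') ->
    \forall q \near chart_map z, M q -> exists2 z', U z' & q = chart_map z';
  chart_regions : forall A, regions M D A -> exists z, A (chart_map z) }.

Section Transfer.
Variables (R : realType) (M : set 'rV[R]_3) (D : set 'rV[R]_3) (g : R -> 'rV[R]_3).
Hypothesis (hD : knot_projection M D g).
Variable c : chart M D g.
Variables (n : nat) (v : 'I_n -> 'rV[R]_3) (r : 'I_n.+2 -> set 'rV[R]_3).
Hypothesis (hv : set_bij [set: 'I_n] (crossings g) v).
Hypothesis (hr : set_bij [set: 'I_n.+2] (regions M D) r).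

Local Notation phi := (chart_map c).
Local Notation pt := (chart_point c).
Local Notation vel := (chart_velocity c).

Let gP := hD.1.

Lemma pt_eq t t' : pt t = pt t' <-> g t = g t'.
Proof.
split=> [E|E]; first by rewrite -!(chart_mapK c) E.
by apply: (chart_inj (c := c)); rewrite !chart_mapK.
Qed.

Lemma pt_periodic t : pt (t + 1) = pt t.
Proof. exact/pt_eq/(immersion_periodic gP). Qed.

Lemma vel_periodic t : vel (t + 1) = vel t.
Proof.
have E1 := @derive_val _ _ _ _ _ _ _ (chart_derive1 c (t + 1)).
have E2 := @derive_val _ _ _ _ _ _ _ (chart_derive2 c (t + 1)).
rewrite derive_loop in E1; last by move=> u; rewrite pt_periodic.
rewrite derive_loop in E2; last by move=> u; rewrite pt_periodic.
have F1 := @derive_val _ _ _ _ _ _ _ (chart_derive1 c t).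
have F2 := @derive_val _ _ _ _ _ _ _ (chart_derive2 c t).
by rewrite [LHS]surjective_pairing -E1 -E2 F1 F2 -surjective_pairing.
Qed.

Lemma vel_neq0 t : vel t <> (0, 0).
Proof.
move=> E; have := immersion_regular gP t.
by rewrite (chart_chain c) E !scale0r addr0 eqxx.
Qed.

(** The chart maps a linear relation between the velocities in the plane to the
    same relation between the velocities in space. *)
Lemma vel_transverse s t : s \in `[0, 1[ -> t \in `[0, 1[ -> s != t -> g s = g t ->
  cross (vel s) (vel t) != 0.
Proof.
move=> s01 t01 st E; apply/eqP => cr0.
have := transverse_crossings gP s01 t01 st E.
rewrite !(chart_chain c) (pt_eq s t).2 //.
set J1 := chart_partial1 _ _; set J2 := chart_partial2 _ _.
move: cr0 (@vel_neq0 s) (@vel_neq0 t); rewrite /cross.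
case: (vel s) (vel t) => [a1 a2] [b1 b2] /= cr0 a0 b0.
move=> /row_freeP [B BE].
have key x y : x *: (a1 *: J1 + a2 *: J2) + y *: (b1 *: J1 + b2 *: J2) = 0 ->
    x = 0 /\ y = 0.
  move=> h; have : row_mx (@scalar_mx R 1 x) (@scalar_mx R 1 y) *m
      col_mx (a1 *: J1 + a2 *: J2) (b1 *: J1 + b2 *: J2) *m B = 0.
    by rewrite mul_row_col !mul_scalar_mx h mul0mx.
  rewrite -mulmxA BE mulmx1 => /rowP h0; split.
    by have := h0 (lshift 1 0); rewrite row_mxEl !mxE eqxx mulr1n.
  by have := h0 (rshift 1 0); rewrite row_mxEr !mxE eqxx mulr1n.
have comb x y : x * a1 + y * b1 = 0 -> x * a2 + y * b2 = 0 -> x = 0 /\ y = 0.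
  move=> h1 h2; apply: key; rewrite !scalerDr !scalerA addrACA -!scalerDl h1 h2.
  by rewrite !scale0r addr0.
have [|| b10 a10] := comb b1 (- a1); [by ring| by lra|].
have [|| b20 a20] := comb b2 (- a2); [by lra| by ring|].
by apply: b0; rewrite b10 b20.
Qed.

(** Exchanging the two visits changes the sign of the cross product. *)
Lemma crossing_params i : exists ab : R * R,
  [/\ ab.1 \in `[0, 1[, ab.2 \in `[0, 1[, g ab.1 = v i, g ab.2 = v i &
      0 < cross (vel ab.1) (vel ab.2)].
Proof.
have [s [t [s01 t01 st gs gt]]] : crossings g (v i) by case: hv => fv _ _; exact: fv.
have tr := vel_transverse s01 t01 st (etrans gs (esym gt)).
have [neg|pos|/eqP] := ltgtP (cross (vel s) (vel t)) 0; last by rewrite (negPf tr).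
  exists (t, s); split => //=.
  have -> : cross (vel t) (vel s) = - cross (vel s) (vel t) by rewrite /cross; ring.
  by rewrite oppr_gt0.
by exists (s, t).
Qed.

Definition region_label (z : R * R) : 'I_n.+2 :=
  xget ord0 [set j | r j = connected_component (M `\` D) (phi z)].

Lemma phi_D z : D (phi z) <-> range pt z.
Proof.
have Dg q : D q <-> range g q by rewrite hD.2.
split=> [/Dg [t _ tE]|[t _ <-]]; last by apply/Dg; exists t; rewrite ?chart_mapK.
by exists t => //; apply: (chart_inj (c := c)); rewrite chart_mapK.
Qed.

Lemma phi_off z : ~ range pt z -> (M `\` D) (phi z).
Proof. by move=> off; split; [exact: chart_in|move/phi_D]. Qed.

Lemma region_labelE z : ~ range pt z ->
  r (region_label z) = connected_component (M `\` D) (phi z).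
Proof.
move=> off; apply: (@xgetPex _ _ [set j | r j = _]).
have [_ _ sr] := hr; have [|j _ jE] := sr (connected_component (M `\` D) (phi z)).
  by exists (phi z) => //; exact: phi_off.
by exists j.
Qed.

Lemma region_sub j : r j `<=` M `\` D.
Proof.
have [fr _ _] := hr; have [q _ <-] := fr j I.
exact: connected_component_sub.
Qed.

Lemma region_component j q : r j q -> r j = connected_component (M `\` D) q.
Proof.
have [fr _ _] := hr; have [q' _ <-] := fr j I.
exact: same_connected_component.
Qed.

Lemma region_label_unique z j : r j (phi z) -> region_label z = j.
Proof.
move=> jz; have off : ~ range pt z by move/phi_D; have [] := region_sub jz.
have [_ ir _] := hr; apply: ir; rewrite ?inE //.
by rewrite (region_labelE off) (region_component jz).
Qed.

Lemma region_label_in z : ~ range pt z -> r (region_label z) (phi z).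
Proof.
by move=> off; rewrite (region_labelE off); apply: connected_component_refl; exact: phi_off.
Qed.

Lemma continuous_pt : continuous pt.
Proof.
have c1 : continuous (fun u => (pt u).1).
  move=> t; have /derivable1_diffP := @ex_derive _ _ _ _ _ _ _ (chart_derive1 c t).
  exact: differentiable_continuous.
have c2 : continuous (fun u => (pt u).2).
  move=> t; have /derivable1_diffP := @ex_derive _ _ _ _ _ _ _ (chart_derive2 c t).
  exact: differentiable_continuous.
have -> : pt = fun u => ((pt u).1, (pt u).2) by apply/funext => u; case: pt.
exact: continuous_pair.
Qed.

(** A segment off the curve is mapped into a single component. *)
Lemma region_label_constant z : ~ range pt z ->
  \forall z' \near z, region_label z' = region_label z.
Proof.
move=> off.
have cl : closed (range pt).
  by apply: closed_loop; [exact: norm_hausdorff|exact: continuous_pt|exact: pt_periodic].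
have /nbhs_ballP [d /= d0 dP] := open_nbhs_nbhs (conj (closed_openC cl) off).
apply/nbhs_ballP; exists d => // z' [b1 b2].
pose p := segment z z'.
have p0 : p 0 = z by exact: segment0.
have p1 : p 1 = z' by exact: segment1.
have cp : continuous p by exact: continuous_segment.
have offp x : 0 <= x <= 1 -> ~ range pt (p x).
  have scale (y : R) : `|y| < d -> 0 <= x <= 1 -> `|x * y| < d.
    move=> yd /andP[x0 x1]; rewrite normrM (ger0_norm x0); apply: le_lt_trans yd.
    by rewrite ler_piMl.
  move=> x01; apply: dP; split; rewrite -ball_normE /= opprD addrA subrr sub0r normrN;
    apply: scale => //; [move: b1|move: b2]; by rewrite -ball_normE /= distrC.
apply: region_label_unique; rewrite (region_labelE off).
have cimg : connected ((phi \o p) @` `[0, 1]%classic).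
  apply: connected_continuous_connected; first exact: segment_connected.
  apply: continuous_subspaceT => x; apply: continuous_comp; first exact: cp.
  exact: chart_continuous.
apply: (connected_component_max _ _ cimg).
- by exists 0; rewrite /= ?p0 // in_itv /= lexx ler01.
- by move=> q [x /= /[!in_itv] /= x01 <-]; exact/phi_off/offp.
- by exists 1; rewrite /= ?p1 // in_itv /= lexx ler01.
Qed.

Lemma region_label_onto j : exists z, ~ range pt z /\ region_label z = j.
Proof.
have [fr _ _] := hr; have [z jz] := chart_regions c (fr j I).
exists z; split; last exact: region_label_unique.
by move/phi_D; have [] := region_sub jz.
Qed.

(** A crossing is on the curve, hence outside every region, so that it lies on
    the boundary of a region as soon as it is adherent to it. *)
Lemma boundary_label i j (p : R * R) : phi p = v i -> range pt p ->
  boundary_in M (r j) (v i) <->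
  forall U : R * R -> Prop, (\forall z \near p, U z) ->
    exists z, [/\ U z, ~ range pt z & region_label z = j].
Proof.
move=> <- rp; have Dp : D (phi p) by apply/phi_D.
split=> [[[_ cl] _] U nU|adh].
  have [q [jq /(_ (region_sub jq).1) [z Uz qE]]] := cl _ (chart_open c nU).
  rewrite qE in jq; exists z; split => //; last exact: region_label_unique.
  by move/phi_D; have [] := region_sub jq.
split; first split; first exact: chart_in.
  move=> W nW; have [z [Wz off zj]] := adh (fun z => W (phi z)) (chart_continuous (c := c) nW).
  by exists (phi z); split => //; rewrite -zj; exact: region_label_in.
apply: subset_closure; split; first exact: chart_in.
by move=> /region_sub [].
Qed.

Lemma region_choice_surjective (b : 'cV[int]_n) :
  exists u : 'cV[int]_n.+2, region_choice_mx1 M v r *m u + b = 0.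
Proof.
have [ab abP] := boolp.choice crossing_params.
have [fv iv sv] := hv.
pose ctime (s : bool) i := if s then (ab i).2 else (ab i).1.
have ctime01 s i : ctime s i \in `[0, 1[ by rewrite /ctime; have [] := abP i; case: s.
have gtime s i : g (ctime s i) = v i by rewrite /ctime; have [] := abP i; case: s.
have time_ge0 s i : 0 <= ctime s i by have := ctime01 s i; rewrite in_itv /= => /andP[].
have time_lt1 s i : ctime s i < 1 by have := ctime01 s i; rewrite in_itv /= => /andP[].
have ctime_neq i : ctime false i != ctime true i.
  have [_ _ _ _] := abP i; rewrite /ctime /=; apply: contraTneq => ->.
  by rewrite /cross mulrC subrr ltxx.
have time_inj s i s' i' : ctime s i = ctime s' i' -> s = s' /\ i = i'.
  move=> E; have ii : i = i' by apply: iv; rewrite ?inE // -(gtime s) -(gtime s') E.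
  split=> //; move: E; rewrite -ii.
  by have := ctime_neq i; case: s; case: s' => // ne E; move: ne; rewrite E eqxx.
have cpoint i : pt (ctime false i) = pt (ctime true i) by apply/pt_eq; rewrite !gtime.
have cpos i : 0 < cross (vel (ctime false i)) (vel (ctime true i)) by have [] := abP i.
have double t t' : pt t = pt t' ->
    (exists k : int, t = t' + k%:~R) \/
    (exists s i (k k' : int), t = ctime s i + k%:~R /\ t' = ctime (~~ s) i + k'%:~R).
  move=> /pt_eq E.
  have frac (x : R) : exists k : int, x - k%:~R \in `[0, 1[.
    by have [k kx] := unit_time x; exists k; rewrite in_itv.
  have [k kE] := frac t; have [k' k'E] := frac t'.
  have gk x (l : int) : g (x - l%:~R) = g x.
    by rewrite -[in RHS](subrK l%:~R x) (loop_shift (immersion_periodic gP)).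
  set t0 := t - k%:~R in kE; set t0' := t' - k'%:~R in k'E.
  have tE : t = t0 + k%:~R by rewrite subrK.
  have t'E : t' = t0' + k'%:~R by rewrite subrK.
  have [e|ne] := eqVneq t0 t0'.
    by left; exists (k - k'); rewrite tE e intrB /t0'; ring.
  right; have g0 : g t0 = g t0' by rewrite /t0 /t0' !gk.
  have [|i _ iE] := sv (g t0); first by exists t0, t0'; split.
  have trip s : ctime s i = t0 \/ ctime s i = t0'.
    have gs : g t0' = g (ctime s i) by rewrite gtime iE g0.
    have [e|e|e] := no_triple_point gP kE k'E (ctime01 s i) g0 gs.
    - by move: ne; rewrite e eqxx.
    - by right.
    - by left.
  have := ctime_neq i.
  case: (trip false) => fE; case: (trip true) => tE'; rewrite ?fE ?tE' ?eqxx // => _.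
    by exists false, i, k, k'; rewrite fE tE' -tE -t'E.
  by exists true, i, k, k'; rewrite fE tE' -tE -t'E.
pose C := LabelledCurve pt_periodic vel_periodic (chart_derive1 c) (chart_derive2 c)
  (chart_C1 (c := c)) vel_neq0 time_ge0 time_lt1 time_inj cpoint cpos double
  region_label_constant region_label_onto.
have [K KP] := diagram_of_curve C.
have [u uE] := single_count_surjective K (fun i => - b i 0).
exists (\col_j u j); apply/colP => i; rewrite !mxE -[b i 0]opprK -uE.
apply/eqP; rewrite subr_eq0 /single_count [X in _ == X]big_mkcond /=; apply/eqP.
apply: eq_bigr => j _; rewrite !mxE.
have bnd : boundary_in M (r j) (v i) <-> corner K i j.
  have E : phi (pt (ctime false i)) = v i by rewrite chart_mapK gtime.
  have := KP i j; have := boundary_label j E (ex_intro2 _ _ _ I erefl).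
  by rewrite /= => -> ->.
case: ifPn => [/bnd h|h]; first by rewrite asboolT // mul1r.
by rewrite asboolF ?mul0r // => /bnd; apply/negP.
Qed.
End Transfer.

(** * The plane and the sphere *)

Section Space.
Variable R : realType.
Local Notation space := 'rV[R]_3.
Implicit Types (p q : space).

Definition ix : 'I_3 := ord0.
Definition iy : 'I_3 := lift ord0 ord0.
Definition iz : 'I_3 := ord_max.

Lemma ord3P (P : 'I_3 -> Prop) : P ix -> P iy -> P iz -> forall i, P i.
Proof.
move=> P0 P1 P2 [[|[|[|//]]] lt].
- by rewrite (_ : Ordinal lt = ix) //; apply: val_inj.
- by rewrite (_ : Ordinal lt = iy) //; apply: val_inj.
- by rewrite (_ : Ordinal lt = iz) //; apply: val_inj.
Qed.

Lemma sum3 (V : nmodType) (F : 'I_3 -> V) : \sum_i F i = F ix + F iy + F iz.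
Proof.
rewrite !big_ord_recl big_ord0 addr0 addrA; congr (_ + _ + F _).
exact: val_inj.
Qed.

Definition row3 (x y z : R) : space := \row_j nth 0 [:: x; y; z] j.

Lemma row3E q : q = row3 (q 0 ix) (q 0 iy) (q 0 iz).
Proof. by apply/rowP; apply: ord3P; rewrite mxE. Qed.

Lemma coord_derive (g : R -> space) k : (forall t : R, derivable g t 1) ->
  forall t : R, is_derive t (1 : R) (fun u : R => g u 0 k : R) (derive1 g t 0 k).
Proof.
move=> dg t; have /derivable_mxP dgt := dg t.
apply: DeriveDef; first exact: dgt.
by rewrite derive1E derive_mx // mxE.
Qed.

Lemma continuous_coord (T : topologicalType) (f : T -> space) k :
  continuous f -> continuous (fun x => f x 0 k).
Proof.
move=> cf x; apply: (@continuous_comp _ _ _ f (fun q : space => q 0 k)); first exact: cf.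
exact: coord_continuous.
Qed.

Lemma continuous_row3 (T : topologicalType) (f1 f2 f3 : T -> R) :
  continuous f1 -> continuous f2 -> continuous f3 ->
  continuous (fun x => row3 (f1 x) (f2 x) (f3 x)).
Proof.
move=> c1 c2 c3; have -> : (fun x => row3 (f1 x) (f2 x) (f3 x)) =
    (fun x => f1 x *: row3 1 0 0 + f2 x *: row3 0 1 0 + f3 x *: row3 0 0 1).
  by apply/funext => x; apply/rowP; apply: ord3P; rewrite !mxE /=; ring.
move=> x; apply: cvgD; first apply: cvgD.
- exact: cvgZr_tmp (c1 x).
- exact: cvgZr_tmp (c2 x).
- exact: cvgZr_tmp (c3 x).
Qed.

Lemma plane_chart (D : set space) (g : R -> space) :
  knot_projection (coordinate_plane R) D g -> inhabited (chart (coordinate_plane R) D g).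
Proof.
move=> [gP DE].
pose phi (z : R * R) := row3 z.1 z.2 0.
pose psi q : R * R := (q 0 ix, q 0 iy).
have phiK : cancel phi psi by case=> x y; rewrite /psi /phi !mxE.
have psiK q : coordinate_plane R q -> phi (psi q) = q.
  by move=> q0; rewrite [RHS]row3E /phi /psi /=; congr row3; rewrite q0.
have gM := immersion_in gP.
have dg k t := coord_derive k (immersion_derivable gP) t.
have cphi : continuous phi.
  by apply: continuous_row3 => z; [exact: cvg_fst|exact: cvg_snd|exact: cvg_cst].
have cpsi : continuous psi by apply: continuous_pair => q; exact: coord_continuous.
apply/inhabits/(@Chart R _ D g phi (psi \o g) (fun t => psi (derive1 g t))
  (fun=> row3 1 0 0) (fun=> row3 0 1 0)) => //.
- by move=> z; rewrite /coordinate_plane /= mxE.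
- exact: can_inj phiK.
- by move=> t; apply: psiK.
- by move=> t; apply: continuous_comp; [exact: (immersion_C1 gP)|exact: cpsi].
- move=> t; have d2 : derive1 g t 0 iz = 0.
    have d2 := @derive_val _ _ _ _ _ _ _ (dg iz t).
    have g2 : (fun u => g u 0 iz) = cst 0 by apply/funext => u; exact: gM.
    by rewrite -d2 g2 derive_cst.
  by apply/rowP; apply: ord3P; rewrite !mxE /= ?d2; ring.
- move=> z U nU; have nU' : \forall q \near phi z, U (psi q).
    by rewrite -(phiK z) in nU; exact: (cpsi _ _ nU).
  by apply: filterS nU' => q Uq Mq; exists (psi q); rewrite ?psiK.
- move=> A [q [Mq nDq] <-]; exists (psi q); rewrite psiK //.
  exact: connected_component_refl.
Qed.

Lemma unit_sphereE q : unit_sphere R q <-> q 0 ix ^+ 2 + q 0 iy ^+ 2 + q 0 iz ^+ 2 = 1.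
Proof. by rewrite /unit_sphere /= sum3. Qed.

(** Stereographic projection is written for the pole [row3 0 0 1] and carried
    to other poles by an orthogonal matrix. *)
Lemma orthonormal_frame q : unit_sphere R q ->
  exists U : 'M[R]_3, U *m U^T = 1%:M /\ row3 0 0 1 *m U = q.
Proof.
move=> /unit_sphereE; rewrite (row3E q) !mxE /=.
move: (q 0 ix) (q 0 iy) (q 0 iz) => a b c abc.
pose mk (u v w : space) : 'M[R]_3 := \matrix_(i, j) nth 0 [:: u 0 j; v 0 j; w 0 j] i.
have mkE u v w : row3 0 0 1 *m mk u v w = w.
  by apply/rowP; apply: ord3P; rewrite !mxE sum3 !mxE /=; ring.
(* In general U is the rotation about a horizontal axis that takes the north
   pole to q; it is undefined at the south pole, where changing the sign of
   the third coordinate does the same. *)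
have [c0|c0] := eqVneq (1 + c) 0.
  exists (mk (row3 1 0 0) (row3 0 1 0) (row3 a b c)); split=> //.
  have cE : c = -1 by lra.
  have ab : a ^+ 2 + b ^+ 2 = 0 by rewrite cE in abc; lra.
  have a0 : a = 0 by apply/eqP; rewrite -sqrf_eq0; apply/eqP; nra.
  have b0 : b = 0 by apply/eqP; rewrite -sqrf_eq0; apply/eqP; nra.
  rewrite a0 b0 cE; apply/matrixP => i j; rewrite !mxE sum3 !mxE.
  move: i; apply: ord3P; move: j; apply: ord3P; rewrite /=; ring.
pose k := (1 + c)^-1.
exists (mk (row3 (1 - k * a ^+ 2) (- (k * a * b)) (- a))
           (row3 (- (k * a * b)) (1 - k * b ^+ 2) (- b)) (row3 a b c)); split=> //.
have kE : k * (1 + c) = 1 by rewrite mulVf.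
have abE : a ^+ 2 + b ^+ 2 = (1 - c) * (1 + c) by rewrite -[1 in RHS]mulr1; lra.
have kab : k * (a ^+ 2 + b ^+ 2) = 1 - c by rewrite abE mulrCA kE mulr1.
have comb x y z w : x - y = z * (k * (a ^+ 2 + b ^+ 2) - (1 - c)) -
    w * (k * (1 + c) - 1) -> x = y.
  by rewrite kab kE !subrr !mulr0 subrr => /subr0_eq.
apply/matrixP => i j; rewrite !mxE sum3 !mxE.
move: i; apply: ord3P; move: j; apply: ord3P; rewrite /= ?mulr1n ?mulr0n.
- by apply: (comb _ _ (k * a ^+ 2) (a ^+ 2)); ring.
- by apply: (comb _ _ (k * a * b) (a * b)); ring.
- by apply: (comb _ _ (- a) 0); ring.
- by apply: (comb _ _ (k * a * b) (a * b)); ring.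
- by apply: (comb _ _ (k * b ^+ 2) (b ^+ 2)); ring.
- by apply: (comb _ _ (- b) 0); ring.
- by apply: (comb _ _ (- a) 0); ring.
- by apply: (comb _ _ (- b) 0); ring.
- by rewrite -!expr2.
Qed.

Lemma sphere_mul (U : 'M[R]_3) q : U *m U^T = 1%:M ->
  unit_sphere R (q *m U) <-> unit_sphere R q.
Proof.
move=> UU.
have normE p : \sum_i p 0 i ^+ 2 = (p *m p^T) 0 0.
  by rewrite mxE; apply: eq_bigr => i _; rewrite mxE expr2.
by rewrite /unit_sphere /= !normE trmx_mul mulmxA -(mulmxA q) UU mulmx1.
Qed.

(** The inverse of stereographic projection from the pole [row3 0 0 1]. *)
Definition stereo (z : R * R) : space :=
  let s := z.1 ^+ 2 + z.2 ^+ 2 in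
  row3 (2 * z.1 / (s + 1)) (2 * z.2 / (s + 1)) ((s - 1) / (s + 1)).

Definition stereo_inv q : R * R := (q 0 ix / (1 - q 0 iz), q 0 iy / (1 - q 0 iz)).

Lemma stereo_den (z : R * R) : z.1 ^+ 2 + z.2 ^+ 2 + 1 != 0.
Proof. by rewrite gt_eqF // ltr_wpDl // addr_ge0 // sqr_ge0. Qed.

Lemma stereo_sphere z : unit_sphere R (stereo z).
Proof.
apply/unit_sphereE; rewrite !mxE /=; have := stereo_den z.
move: z.1 z.2 => x y D; field; exact: D.
Qed.

Lemma stereo_not_pole z : stereo z 0 iz != 1.
Proof.
rewrite mxE /=; apply/eqP => /(congr1 (fun x => x * (z.1 ^+ 2 + z.2 ^+ 2 + 1))).
by rewrite divfK ?stereo_den // mul1r; lra.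
Qed.

Lemma stereoK : cancel stereo stereo_inv.
Proof.
move=> z; rewrite /stereo_inv /stereo !mxE /= [RHS]surjective_pairing.
have := stereo_den z; move: z.1 z.2 => x y D.
have E : 1 - (x ^+ 2 + y ^+ 2 - 1) / (x ^+ 2 + y ^+ 2 + 1) = 2 / (x ^+ 2 + y ^+ 2 + 1).
  by field; exact: D.
by rewrite E; congr (_, _); field; rewrite ?D ?andbT /=; try exact: D.
Qed.

Lemma stereo_invK q : unit_sphere R q -> q 0 iz != 1 -> stereo (stereo_inv q) = q.
Proof.
move=> /unit_sphereE abc c1; rewrite [RHS]row3E /stereo /stereo_inv /=.
move: (q 0 ix) (q 0 iy) (q 0 iz) abc c1 => a b c abc c1.
have c1' : 1 - c != 0 by rewrite subr_eq0 eq_sym.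
have sE : (a / (1 - c)) ^+ 2 + (b / (1 - c)) ^+ 2 = (1 + c) / (1 - c).
  apply: (mulIf (mulf_neq0 c1' c1')).
  transitivity (a ^+ 2 + b ^+ 2); first by field; exact: c1'.
  have -> : a ^+ 2 + b ^+ 2 = (1 - c) * (1 + c) by lra.
  by field; exact: c1'.
have s1 : (1 + c) / (1 - c) + 1 = 2 / (1 - c) by field; exact: c1'.
by rewrite sE s1; congr row3; field; rewrite ?c1'.
Qed.

Lemma pole_row q : unit_sphere R q -> q 0 iz = 1 -> q = row3 0 0 1.
Proof.
move=> /unit_sphereE E q2; rewrite q2 in E; rewrite [LHS]row3E q2.
have a0 : q 0 ix = 0 by apply/eqP; rewrite -sqrf_eq0; apply/eqP; nra.
have b0 : q 0 iy = 0 by apply/eqP; rewrite -sqrf_eq0; apply/eqP; nra.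
by rewrite a0 b0.
Qed.

Lemma continuous_stereo : continuous stereo.
Proof.
have c1 : continuous (fst : R * R -> R) by move=> z; exact: cvg_fst.
have c2 : continuous (snd : R * R -> R) by move=> z; exact: cvg_snd.
have cs : continuous (fun z : R * R => z.1 ^+ 2 + z.2 ^+ 2).
  by move=> z; apply: cvgD; apply: cvgM; [exact: c1|exact: c1|exact: c2|exact: c2].
have cd : continuous (fun z : R * R => (z.1 ^+ 2 + z.2 ^+ 2 + 1)^-1).
  move=> z; apply: cvgV; first exact: stereo_den.
  by apply: cvgD; [exact: cs|exact: cvg_cst].
apply: continuous_row3 => z; apply: cvgM; try exact: cd.
- by apply: cvgM; [exact: cvg_cst|exact: c1].
- by apply: cvgM; [exact: cvg_cst|exact: c2].
- by apply: cvgB; [exact: cs|exact: cvg_cst].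
Qed.

Lemma continuous_mulmx (T : topologicalType) (f : T -> space) (U : 'M[R]_3) :
  continuous f -> continuous (fun x => f x *m U).
Proof.
move=> cf; have -> : (fun x => f x *m U) = (fun x => row3
    (f x 0 ix * U ix ix + f x 0 iy * U iy ix + f x 0 iz * U iz ix)
    (f x 0 ix * U ix iy + f x 0 iy * U iy iy + f x 0 iz * U iz iy)
    (f x 0 ix * U ix iz + f x 0 iy * U iy iz + f x 0 iz * U iz iz)).
  by apply/funext => x; apply/rowP; apply: ord3P; rewrite !mxE sum3.
have ck k : continuous (fun x => f x 0 k) by exact: continuous_coord.
by apply: continuous_row3 => x; (apply: cvgD; first apply: cvgD); apply: cvgM;
  try exact: cvg_cst; exact: ck.
Qed.

Lemma mulmx_derive (g dg : R -> space) (U : 'M[R]_3) (t : R) :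
    (forall k, is_derive t (1 : R) (fun u : R => g u 0 k : R) (dg t 0 k)) ->
  forall k, is_derive t (1 : R) (fun u : R => (g u *m U) 0 k : R) ((dg t *m U) 0 k).
Proof.
move=> gd k; have d0 := gd ix; have d1 := gd iy; have d2 := gd iz.
have -> : (fun u => (g u *m U) 0 k) = (fun u => g u 0 ix : R) * cst (U ix k) +
    (fun u => g u 0 iy : R) * cst (U iy k) + (fun u => g u 0 iz : R) * cst (U iz k).
  by apply/funext => u; rewrite !mxE sum3.
have dU j (f : R -> R) f' : is_derive t (1 : R) f f' ->
    is_derive t (1 : R) (f * cst (U j k)) (f t *: 0 + U j k *: f').
  by move=> df; exact: (is_deriveM df (is_derive_cst (U j k) t 1)).
apply: (is_derive_eq (is_deriveD (is_deriveD (dU _ _ _ d0) (dU _ _ _ d1)) (dU _ _ _ d2))).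
rewrite mxE sum3 !scaler0 /GRing.scale /=.
move: (dg t 0 ix) (dg t 0 iy) (dg t 0 iz) (U ix k) (U iy k) (U iz k).
by move=> *; ring.
Qed.

(** The partial derivatives of [stereo]. They are polynomials in the two
    coordinates and in d, the distance from the image of z to the tangent plane
    at the pole. *)
Definition stereo_partial1 (z : R * R) : space :=
  let d := 2 / (z.1 ^+ 2 + z.2 ^+ 2 + 1) in
  row3 (d - z.1 * (d ^+ 2 * z.1)) (- (z.2 * (d ^+ 2 * z.1))) (d ^+ 2 * z.1).

Definition stereo_partial2 (z : R * R) : space :=
  let d := 2 / (z.1 ^+ 2 + z.2 ^+ 2 + 1) in
  row3 (- (z.1 * (d ^+ 2 * z.2))) (d - z.2 * (d ^+ 2 * z.2)) (d ^+ 2 * z.2).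

(** The coefficients are the derivatives of the two coordinates of
    [stereo_inv] along a curve through p with velocity p'. *)
Lemma stereo_chain p p' : unit_sphere R p -> p 0 iz != 1 ->
    p 0 ix * p' 0 ix + p 0 iy * p' 0 iy + p 0 iz * p' 0 iz = 0 ->
  let d := 1 - p 0 iz in
  p' = ((p' 0 ix * d + p 0 ix * p' 0 iz) / d ^+ 2) *: stereo_partial1 (stereo_inv p) +
       ((p' 0 iy * d + p 0 iy * p' 0 iz) / d ^+ 2) *: stereo_partial2 (stereo_inv p).
Proof.
move=> /unit_sphereE pp p2 orth; rewrite /=.
rewrite [LHS]row3E /stereo_partial1 /stereo_partial2 /stereo_inv /=.
move: (p 0 ix) (p 0 iy) (p 0 iz) (p' 0 ix) (p' 0 iy) (p' 0 iz) pp p2 orth.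
move=> a b c a' b' c' pp c1 orth.
have d0 : 1 - c != 0 by rewrite subr_eq0 eq_sym.
have sE : 2 / ((a / (1 - c)) ^+ 2 + (b / (1 - c)) ^+ 2 + 1) = 1 - c.
  have -> : (a / (1 - c)) ^+ 2 + (b / (1 - c)) ^+ 2 + 1 = 2 / (1 - c).
    apply: (mulIf (mulf_neq0 d0 d0)).
    transitivity (a ^+ 2 + b ^+ 2 + (1 - c) ^+ 2); first by field; exact: d0.
    have -> : a ^+ 2 + b ^+ 2 + (1 - c) ^+ 2 = 2 * (1 - c).
      by rewrite (_ : a ^+ 2 + b ^+ 2 = 1 - c ^+ 2); [ring|lra].
    by field; exact: d0.
  by field; rewrite d0.
rewrite sE.
have c'E : c' = (a' * (1 - c) + a * c') / (1 - c) ^+ 2 * ((1 - c) ^+ 2 * (a / (1 - c))) +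
    (b' * (1 - c) + b * c') / (1 - c) ^+ 2 * ((1 - c) ^+ 2 * (b / (1 - c))).
  apply: (mulIf d0); transitivity ((a * a' + b * b') * (1 - c) + (a ^+ 2 + b ^+ 2) * c').
    have -> : a * a' + b * b' = - (c * c') by lra.
    by rewrite (_ : a ^+ 2 + b ^+ 2 = 1 - c ^+ 2); [ring|lra].
  by field; exact: d0.
apply/rowP; apply: ord3P; rewrite !mxE /=; last by [].
  transitivity ((a' * (1 - c) + a * c') / (1 - c) ^+ 2 * (1 - c) - a / (1 - c) * c').
    by field; exact: d0.
  by rewrite [in X in _ - _ * X]c'E; field; exact: d0.
transitivity ((b' * (1 - c) + b * c') / (1 - c) ^+ 2 * (1 - c) - b / (1 - c) * c').
  by field; exact: d0.
by rewrite [in X in _ - _ * X]c'E; field; exact: d0.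
Qed.

Lemma near_neq (T : topologicalType) (f : T -> R) x y : continuous f -> f x != y ->
  \forall x' \near x, f x' != y.
Proof.
move=> cf fxy; have e0 : 0 < `|f x - y| by rewrite normr_gt0 subr_eq0.
have nf : \forall x' \near x, ball (f x) `|f x - y| (f x') by exact: (cf x _ (nbhsx_ballx _ _ e0)).
by apply: filterS nf => x'; rewrite -ball_normE /=; apply: contraTneq => ->; rewrite ltxx.
Qed.

Lemma stereo_inv_continuous_at (T : topologicalType) (f : T -> space) x :
  continuous f -> f x 0 iz != 1 -> {for x, continuous (stereo_inv \o f)}.
Proof.
move=> cf fx; have ck k : continuous (fun y => f y 0 k) by exact: continuous_coord.
have cd : (fun y => (1 - f y 0 iz)^-1) @ x --> (1 - f x 0 iz)^-1.
  have d0 : 1 - f x 0 iz != 0 by rewrite subr_eq0 eq_sym.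
  by apply: cvgV => //; apply: cvgB; [exact: cvg_cst|exact: ck].
apply: (@cvg_pair _ _ _ _ (nbhs (f x 0 ix / (1 - f x 0 iz))) (nbhs (f x 0 iy / (1 - f x 0 iz)))).
  by apply: cvgM; [exact: ck|exact: cd].
by apply: cvgM; [exact: ck|exact: cd].
Qed.

(** The pole is not isolated on the sphere, so the region that contains it has
    points in the chart. *)
Lemma sphere_path (U : 'M[R]_3) : U *m U^T = 1%:M ->
  exists c : R -> space, [/\ continuous c, c 0 = row3 0 0 1 *m U,
    forall t, unit_sphere R (c t) & forall t, t != 0 -> c t <> c 0].
Proof.
move=> UU; pose f t : space := row3 (2 * t / (1 + t ^+ 2)) 0 ((1 - t ^+ 2) / (1 + t ^+ 2)).
have den (t : R) : 1 + t ^+ 2 != 0 by rewrite gt_eqF // ltr_pwDl // sqr_ge0.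
exists (fun t => f t *m U); split.
- have cs : continuous (fun t : R => t ^+ 2) by move=> t; exact: exprn_continuous.
  have cd : continuous (fun t : R => (1 + t ^+ 2)^-1).
    move=> t; apply: cvgV; first exact: den.
    by apply: cvgD; [exact: cvg_cst|exact: cs].
  apply: continuous_mulmx; apply: continuous_row3 => t; try exact: cvg_cst.
    by apply: cvgM; [apply: cvgM; [exact: cvg_cst|exact: cvg_id]|exact: cd].
  by apply: cvgM; [apply: cvgB; [exact: cvg_cst|exact: cs]|exact: cd].
- congr (_ *m _); rewrite /f; congr row3; first by rewrite mulr0 mul0r.
  by rewrite expr0n /= subr0 addr0 divff.
- move=> t; apply/sphere_mul => //; apply/unit_sphereE; rewrite !mxE /=.
  by field; exact: den.
move=> t t0 /(congr1 (mulmx^~ U^T)); rewrite -!mulmxA UU !mulmx1.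
move=> /(congr1 (fun q : space => q 0 ix)); rewrite !mxE /= mulr0 mul0r.
move=> /eqP; rewrite mulf_eq0 invr_eq0 (negPf (den t)) orbF mulf_eq0 pnatr_eq0 /=.
by rewrite (negPf t0).
Qed.

Lemma sphere_chart (D : set space) (g : R -> space) (N : space) :
  knot_projection (unit_sphere R) D g -> (unit_sphere R `\` D) N ->
  inhabited (chart (unit_sphere R) D g).
Proof.
move=> [gP DE] [NM ND].
have [U [UU NE]] := orthonormal_frame NM.
have VU : U^T *m U = 1%:M by exact: mulmx1C.
have VV : U^T *m (U^T)^T = 1%:M by rewrite trmxK.
pose phi z := stereo z *m U; pose psi q := stereo_inv (q *m U^T).
have cphi : continuous phi by apply: continuous_mulmx; exact: continuous_stereo.
have phiM z : unit_sphere R (phi z) by apply/sphere_mul => //; exact: stereo_sphere.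
have phiK : cancel phi psi by move=> z; rewrite /phi /psi -mulmxA UU mulmx1 stereoK.
have not_pole q : unit_sphere R q -> q <> N -> (q *m U^T) 0 iz != 1.
  move=> qM qN; apply/eqP => q2; apply: qN; rewrite -NE -[LHS]mulmx1 -VU mulmxA.
  by rewrite (pole_row _ q2) //; apply/sphere_mul.
have psiK q : unit_sphere R q -> q <> N -> phi (psi q) = q.
  move=> qM qN; rewrite /phi /psi stereo_invK ?not_pole //; last by apply/sphere_mul.
  by rewrite -mulmxA VU mulmx1.
have gM := immersion_in gP.
have gN t : g t <> N by move=> gt; apply: ND; rewrite DE -gt; exists t.
pose P t := g t *m U^T; pose P' t := derive1 g t *m U^T; pose d t := 1 - P t 0 iz.
have PM t : unit_sphere R (P t) by apply/sphere_mul.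
have P2 t : P t 0 iz != 1 by exact: not_pole.
have d0 t : d t != 0 by rewrite /d subr_eq0 eq_sym.
have dP k t : is_derive t (1 : R) (fun u : R => P u 0 k : R) (P' t 0 k).
  by apply: mulmx_derive => k'; exact: coord_derive (immersion_derivable gP) t.
pose vel t := ((P' t 0 ix * d t + P t 0 ix * P' t 0 iz) / d t ^+ 2,
               (P' t 0 iy * d t + P t 0 iy * P' t 0 iz) / d t ^+ 2).
have dquot k t : is_derive t (1 : R) (fun u : R => P u 0 k / d u : R)
    ((P' t 0 k * d t + P t 0 k * P' t 0 iz) / d t ^+ 2).
  have dk := dP k t; have d2 := dP iz t.
  have dd : is_derive t (1 : R) (d : R -> R) (0 - P' t 0 iz).
    by rewrite (_ : d = cst 1 - (fun u => P u 0 iz)) //; exact: is_deriveB.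
  have dV := is_deriveV (d0 t) dd.
  have -> : (fun u : R => P u 0 k / d u : R) = (fun u => P u 0 k) * (fun u => (d u)^-1) by [].
  apply: is_derive_eq; rewrite /GRing.scale /=; field; exact: d0.
have orth t : P t 0 ix * P' t 0 ix + P t 0 iy * P' t 0 iy + P t 0 iz * P' t 0 iz = 0.
  have e0 := dP ix t; have e1 := dP iy t; have e2 := dP iz t.
  have E : (fun u : R => P u 0 ix : R) * (fun u => P u 0 ix) +
     (fun u : R => P u 0 iy : R) * (fun u => P u 0 iy) +
     (fun u : R => P u 0 iz : R) * (fun u => P u 0 iz) = cst 1.
    by apply/funext => u /=; have /unit_sphereE := PM u; rewrite !expr2.
  have := @derive_val _ _ _ _ _ _ _ (is_deriveD (is_deriveD (is_deriveM e0 e0) (is_deriveM e1 e1))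
    (is_deriveM e2 e2)).
  by rewrite E derive_cst /GRing.scale /=; lra.
have cP k : continuous (fun t => P t 0 k).
  apply: continuous_coord; apply: continuous_mulmx => t.
  apply: differentiable_continuous; apply/derivable1_diffP; exact: (immersion_derivable gP).
have cP' k : continuous (fun t => P' t 0 k).
  by apply: continuous_coord; apply: continuous_mulmx; exact: (immersion_C1 gP).
have cd : continuous d by move=> t; apply: cvgB; [exact: cvg_cst|exact: cP].
have cvel : continuous vel.
  have cV : continuous (fun t => (d t ^+ 2)^-1).
    move=> t; apply: cvgV; first by rewrite expf_neq0.
    by apply: cvgM; exact: cd.
  have cquot k : continuous (fun t => (P' t 0 k * d t + P t 0 k * P' t 0 iz) / d t ^+ 2).
    move=> t; apply: cvgM; last exact: cV.
    by apply: cvgD; apply: cvgM; [exact: (cP' k)|exact: cd|exact: (cP k)|exact: (cP' iz)].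
  exact: continuous_pair.
have regions_in A : regions (unit_sphere R) D A -> exists z, A (phi z).
  move=> [q [Mq nDq] <-].
  have [qN|qN] := pselect (q = N); last first.
    by exists (psi q); rewrite psiK //; apply: connected_component_refl.
  have [c [cc c0 cM cneq]] := sphere_path UU; rewrite NE in c0.
  have clD : closed D.
    rewrite DE; apply: closed_loop; first exact: norm_hausdorff.
      move=> t; apply: differentiable_continuous; apply/derivable1_diffP.
      exact: (immersion_derivable gP).
    exact: (immersion_periodic gP).
  have nD : \forall t \near (0 : R), (~` D) (c t).
    apply: cc; rewrite c0; exact: (open_nbhs_nbhs (conj (closed_openC clD) ND)).
  have /nbhs_ballP [e /= e0 eP] := nD.
  have cimg : connected (c @` `[0, e / 2]%classic).
    apply: connected_continuous_connected; first exact: segment_connected.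
    exact: continuous_subspaceT.
  have e2 : 0 < e / 2 by rewrite divr_gt0.
  exists (psi (c (e / 2))); rewrite psiK //; last by rewrite -c0; apply: cneq; rewrite gt_eqF.
  apply: (connected_component_max _ _ cimg).
  - by exists 0; rewrite ?qN //= in_itv /= lexx ltW.
  - move=> _ [t /= /[!in_itv] /= /andP[t0 te] <-]; split=> //; apply: eP.
    by rewrite -ball_normE /= sub0r normrN ger0_norm //; lra.
  - by exists (e / 2) => //=; rewrite in_itv /= lexx ltW.
apply/inhabits/(@Chart R _ D g phi (psi \o g) vel (fun z => stereo_partial1 z *m U)
  (fun z => stereo_partial2 z *m U)) => //.
- exact: can_inj phiK.
- by move=> t; apply: psiK.
- move=> t; rewrite [LHS](_ : _ = P' t *m U); last by rewrite -mulmxA VU mulmx1.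
  by rewrite [in LHS](stereo_chain (PM t) (P2 t) (orth t)) mulmxDl -!scalemxAl.
- move=> z W nW.
  have p2 : (phi z *m U^T) 0 iz != 1.
    by rewrite /phi -mulmxA UU mulmx1 stereo_not_pole.
  have nW' : \forall q \near phi z, W (psi q).
    rewrite -(phiK z) in nW.
    have cm : continuous (fun q : space => q *m U^T) by apply: continuous_mulmx => q; exact: cvg_id.
    exact: (stereo_inv_continuous_at cm p2 nW).
  have np : \forall q \near phi z, (q *m U^T) 0 iz != 1.
    apply: (near_neq (f := fun q : space => (q *m U^T) 0 iz)) => //.
    by apply: continuous_coord; apply: continuous_mulmx => q; exact: cvg_id.
  apply: filterS2 nW' np => q Wq q2 Mq; exists (psi q); rewrite ?psiK // => qN.
  by move: q2; rewrite qN -NE -mulmxA UU mulmx1 mxE eqxx.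
Qed.
End Space.

Theorem theorem4p1 (R : realType) (M : set 'rV[R]_3)
    (hM : M = unit_sphere R \/ M = coordinate_plane R)
    (D : set 'rV[R]_3) (g : R -> 'rV[R]_3) (hD : knot_projection M D g)
    (n : nat) (v : 'I_n -> 'rV[R]_3) (r : 'I_n.+2 -> set 'rV[R]_3)
    (hv : set_bij [set: 'I_n] (crossings g) v)
    (hr : set_bij [set: 'I_n.+2] (regions M D) r)
    (b : 'cV[int]_n) :
  exists u : 'cV[int]_n.+2, region_choice_mx1 M v r *m u + b = 0.
Proof.
have [c] : inhabited (chart M D g).
  case: hM => ME; rewrite ME in hD hr *; last exact: plane_chart.
  have [N ND] : exists N, (unit_sphere R `\` D) N.
    by have [fr _ _] := hr; have [q qMD _] := fr ord0 I; exists q.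
  exact: sphere_chart ND.
exact: (region_choice_surjective hD c hv hr b).
Qed.
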